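(* Let $p,q\in\mathbb C$ with $p\neq0$ and consider the operator $P:\mathcal D'(\mathrm{SU}(2))\to\mathcal D'(\mathrm{SU}(2))$, $Pu:=\partial_0u-qu-p\bar u$. Then $P$ is globally hypoelliptic if and only if $\Delta(\ell)_m:=-m^2+|q|^2-|p|^2-2im\,\mathrm{Re}(q)\neq0$ for all $\ell\in\frac12\mathbb N_0$ and all $m$ with $-\ell\le m\le\ell$, $\ell-m\in\mathbb N_0$.
   Context: $\widehat{\mathrm{SU}(2)}$ consists of the classes of the standard irreducible unitary representations $\mathsf t^\ell:\mathrm{SU}(2)\to\mathbb C^{(2\ell+1)\times(2\ell+1)}$, $\ell\in\frac12\mathbb N_0$ (as in Ruzhansky–Turunen), with matrix entries $\mathsf t^\ell_{mn}$ indexed by $-\ell\le m,n\le\ell$, $\ell-m,\ell-n\in\mathbb N_0$. $\partial_0$ is the neutral left-invariant vector field, whose symbol in these representations is $\sigma_{\partial_0}(\ell)_{mn}=im\delta_{mn}$. For $u\in\mathcal D'$, $\bar u$ is defined by $\langle\bar u,\varphi\rangle=\overline{\langle u,\bar\varphi\rangle}$. $P$ is globally hypoelliptic if $u\in\mathcal D'(\mathrm{SU}(2))$ and $Pu\in C^\infty(\mathrm{SU}(2))$ imply $u\in C^\infty(\mathrm{SU}(2))$. *)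

(* Defs.v *)
From Stdlib Require Import Reals Lra List.
From Coquelicot Require Import Coquelicot.
Open Scope R_scope.

(* SU(2) = { [[a, -conj b],[b, conj a]] : |a|^2+|b|^2 = 1 }, encoded by the
   first column (a,b) in C x C.  Functions on SU(2) are functions C*C -> C;
   only their values on the group matter below. *)
Definition SU2pt := (C * C)%type.
Definition on_SU2 (g : SU2pt) : Prop := Cmod (fst g) ^ 2 + Cmod (snd g) ^ 2 = 1.

(* group law: first column of the matrix product *)
Definition su2_mul (g h : SU2pt) : SU2pt :=
  (Cplus (Cmult (fst g) (fst h)) (Copp (Cmult (Cconj (snd g)) (snd h))),
   Cplus (Cmult (snd g) (fst h)) (Cmult (Cconj (fst g)) (snd h))).

(* three left-invariant directions: one-parameter subgroups exp(t Y_j) *)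
Inductive dir := D0 | D1 | D2.
Definition expY (j : dir) (t : R) : SU2pt :=
  match j with
  | D0 => ((cos (t/2), sin (t/2)), RtoC 0)            (* diag(e^{it/2}, e^{-it/2}) *)
  | D1 => (RtoC (cos (t/2)), RtoC (sin (t/2)))
  | D2 => (RtoC (cos (t/2)), (0, sin (t/2)))
  end.

Definition Xf (j : dir) (f : SU2pt -> C) (g : SU2pt) : C :=
  (Derive (fun t => Re (f (su2_mul g (expY j t)))) 0,
   Derive (fun t => Im (f (su2_mul g (expY j t)))) 0).
Definition ex_Xf (j : dir) (f : SU2pt -> C) (g : SU2pt) : Prop :=
  ex_derive (fun t => Re (f (su2_mul g (expY j t)))) 0 /\
  ex_derive (fun t => Im (f (su2_mul g (expY j t)))) 0.

Definition d0 := Xf D0.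

Fixpoint Xs (js : list dir) (f : SU2pt -> C) : SU2pt -> C :=
  match js with nil => f | j :: js' => Xf j (Xs js' f) end.

Definition continuous_SU2 (f : SU2pt -> C) : Prop :=
  forall g, on_SU2 g -> forall eps, 0 < eps -> exists delta, 0 < delta /\
    forall h, on_SU2 h -> Cmod (Cminus (fst h) (fst g)) < delta ->
      Cmod (Cminus (snd h) (snd g)) < delta -> Cmod (Cminus (f h) (f g)) < eps.

Definition smooth (f : SU2pt -> C) : Prop :=
  forall js, continuous_SU2 (Xs js f) /\
    forall j g, on_SU2 g -> ex_Xf j (Xs js f) g.

(* D'(SU(2)): C-linear functionals on C^infinity continuous for the Frechet
   topology (bounded by a C^k seminorm). *)
Definition distribution (u : (SU2pt -> C) -> C) : Prop :=
  (forall f1 f2, smooth f1 -> smooth f2 ->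
     u (fun g => Cplus (f1 g) (f2 g)) = Cplus (u f1) (u f2)) /\
  (forall (c : C) f, smooth f -> u (fun g => Cmult c (f g)) = Cmult c (u f)) /\
  (exists (K : R) (k : nat), forall f M, smooth f ->
     (forall js, (length js <= k)%nat -> forall g, on_SU2 g -> Cmod (Xs js f g) <= M) ->
     Cmod (u f) <= K * M).

(* normalized Haar integral, in Hopf coordinates
   a = cos eta e^{i alpha}, b = sin eta e^{i beta}, dmu = sin eta cos eta deta dalpha dbeta / (2 pi^2) *)
Definition hopf (eta al be : R) : SU2pt :=
  ((cos eta * cos al, cos eta * sin al), (sin eta * cos be, sin eta * sin be)).
Definition haar_int_R (F : SU2pt -> R) : R :=
  / (2 * PI ^ 2) *
  RInt (fun eta => RInt (fun al => RInt (fun be =>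
     sin eta * cos eta * F (hopf eta al be)) 0 (2 * PI)) 0 (2 * PI)) 0 (PI / 2).
Definition haar_int (F : SU2pt -> C) : C :=
  (haar_int_R (fun g => Re (F g)), haar_int_R (fun g => Im (F g))).

Definition dist_of (f : SU2pt -> C) : (SU2pt -> C) -> C :=
  fun phi => haar_int (fun g => Cmult (f g) (phi g)).

Definition smooth_dist (u : (SU2pt -> C) -> C) : Prop :=
  exists f, smooth f /\ forall phi, smooth phi -> u phi = dist_of f phi.

Definition dconj (u : (SU2pt -> C) -> C) : (SU2pt -> C) -> C :=
  fun phi => Cconj (u (fun g => Cconj (phi g))).
Definition dd0 (u : (SU2pt -> C) -> C) : (SU2pt -> C) -> C :=
  fun phi => Copp (u (d0 phi)).

Definition Pop (p q : C) (u : (SU2pt -> C) -> C) : (SU2pt -> C) -> C :=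
  fun phi => Cminus (Cminus (dd0 u phi) (Cmult q (u phi))) (Cmult p (dconj u phi)).

Definition globally_hypoelliptic (T : ((SU2pt -> C) -> C) -> ((SU2pt -> C) -> C)) : Prop :=
  forall u, distribution u -> smooth_dist (T u) -> smooth_dist u.

Definition Delta_sym (p q : C) (m : R) : C :=
  Cminus (Cminus (Cplus (Copp (Cmult (RtoC m) (RtoC m))) (RtoC (Cmod q ^ 2)))
                 (RtoC (Cmod p ^ 2)))
         (Cmult (Cmult (Cmult (RtoC 2) Ci) (RtoC m)) (RtoC (Re q))).

(* Main.v *)
Require Import Defs.
From Stdlib Require Import ZArith Reals Lra Lia List Classical ClassicalEpsilon.
From Coquelicot Require Import Coquelicot.
Open Scope R_scope.

(** Two obstacles shape the proof. First, [smooth] gives derivatives along the three subgroups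
    [expY j] only, whereas differentiating [S f] along [Y1] brings in the derivative of [f] along
    [cos t Y1 + sin t Y2]. With no chain rule on the group at hand, that derivative is obtained by
    factoring the rotated subgroup through the three given ones and telescoping. Second, [P] is only
    real-linear; this is why the conjugate equation has to be eliminated, and why the periodic
    solutions form a real two-parameter family in [al], from which a complex combination isolates
    one exponential.

    The inverse acts by duality: the equation for [u] is tested against a solution [phi] of the
    transposed equation, so Green operators are only ever applied to smooth functions.

    The length [4 pi] comes from the half angles in [expY] and is the source of the half-integral
    weights. The final contradiction expresses that the circle [|a| = 1] is a Haar null set: the
    test monomials keep their weight on it and decay off it. *)

(** Write [T] for the neutral vector field.  If [P u = f], the conjugate
    equation lets one eliminate the conjugate of [u]:
    [(T - conj q) (T - q) u - |p|^2 u = (T - conj q) f + p conj f].  The left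
    side factors as [(T - l2) (T - l1) u], and the symbol of the product at
    weight [m] is [Delta m].  The orbits of [T] are circles of length [4 pi],
    so [T - l] is inverted on smooth functions by the explicit periodic Green
    operator
    [S f (g) = (e^(-4 pi l) - 1)^-1 int_0^(4 pi) e^(-l t) f (g exp(t Y0)) dt]
    as soon as [l] is not in [(i/2) Z], i.e. as soon as [Delta] has no zero;
    no Fourier analysis on the group is needed.  [S f] is smooth because right
    translation along the orbits rotates [Y1] and [Y2].

    If [Delta m = 0], then [e' = q e + p conj e] has the [4 pi]-periodic
    solutions [e_al t = al e^(i m t) + conj al c e^(-i m t)], and the measures
    [e_al(t) dt] on the circle [exp(t Y0)] are killed by [P].  If these were
    smooth for [al = 1] and [al = i], so would be [e^(i m t) dt]; but testing
    it against [conj a ^ (L + n) * a ^ (2 k + n)] gives [4 pi] for every [n],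
    while the pairing of these monomials with a bounded function tends to 0. *)

(** * The group SU(2) *)

Definition su2_one : SU2pt := (RtoC 1, RtoC 0).

Lemma C_ext (z w : C) : Re z = Re w -> Im z = Im w -> z = w.
Proof. destruct z, w; simpl; intros; subst; reflexivity. Qed.

Lemma Im_le_Cmod (z : C) : Rabs (Im z) <= Cmod z.
Proof. eapply Rle_trans; [apply Rmax_r|apply Rmax_Cmod]. Qed.

Lemma Cmod_sqr (z : C) : Cmod z ^ 2 = fst z * fst z + snd z * snd z.
Proof. rewrite Cmod2_alt. unfold Re, Im. ring. Qed.

(** The constant 2 in place of the square root of 2 is the origin of most factors 2 in the estimates
    below. *)
Lemma Cmod_lt_2 (z : C) (d : R) : Rabs (fst z) < d -> Rabs (snd z) < d -> Cmod z < 2 * d.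
Proof.
intros H1 H2. assert (0 < d) by (generalize (Rabs_pos (fst z)); lra).
apply Rsqr_incrst_0; [|apply Cmod_ge_0|lra].
unfold Rsqr. replace (Cmod z * Cmod z) with (Cmod z ^ 2) by ring. rewrite Cmod_sqr.
apply Rabs_def2 in H1. apply Rabs_def2 in H2. nra.
Qed.

Lemma Cmod_le_2 (z : C) (d : R) : Rabs (fst z) <= d -> Rabs (snd z) <= d -> Cmod z <= 2 * d.
Proof.
intros H1 H2. apply le_epsilon. intros eps He. left.
replace (2 * d + eps) with (2 * (d + eps / 2)) by field. apply Cmod_lt_2; lra.
Qed.

Lemma on_SU2_coord (g : SU2pt) : on_SU2 g <->
  fst (fst g) * fst (fst g) + snd (fst g) * snd (fst g)
  + (fst (snd g) * fst (snd g) + snd (snd g) * snd (snd g)) = 1.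
Proof. unfold on_SU2. rewrite !Cmod_sqr. reflexivity. Qed.

Lemma on_SU2_mul (g h : SU2pt) : on_SU2 g -> on_SU2 h -> on_SU2 (su2_mul g h).
Proof.
rewrite !on_SU2_coord.
destruct g as [[a b] [c d]], h as [[x y] [z t]]; simpl; intros Hg Hh.
rewrite <- (Rmult_1_r 1), <- Hg at 1.
transitivity ((a * a + b * b + (c * c + d * d)) * (x * x + y * y + (z * z + t * t))).
ring. rewrite Hh, Hg; ring.
Qed.

Lemma sin2_cos2_mul (x : R) : sin x * sin x + cos x * cos x = 1.
Proof. apply (sin2_cos2 x). Qed.

Lemma on_SU2_expY (j : dir) (t : R) : on_SU2 (expY j t).
Proof.
apply on_SU2_coord.
generalize (sin2_cos2_mul (t / 2)); destruct j; simpl; lra.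
Qed.

Lemma on_SU2_one : on_SU2 su2_one.
Proof. apply on_SU2_coord; simpl; ring. Qed.

Lemma on_SU2_mul_exp (g : SU2pt) (j : dir) (t : R) : on_SU2 g -> on_SU2 (su2_mul g (expY j t)).
Proof. intros H; apply on_SU2_mul; auto using on_SU2_expY. Qed.

Lemma SU2pt_ext (g h : SU2pt) :
  fst (fst g) = fst (fst h) -> snd (fst g) = snd (fst h) ->
  fst (snd g) = fst (snd h) -> snd (snd g) = snd (snd h) -> g = h.
Proof. destruct g as [[a b] [c d]], h as [[x y] [z t]]; simpl; congruence. Qed.

Lemma su2_mulA (g h k : SU2pt) : su2_mul (su2_mul g h) k = su2_mul g (su2_mul h k).
Proof.
destruct g as [[a b] [c d]], h as [[x y] [z t]], k as [[u v] [r s]].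
apply SU2pt_ext; simpl; ring.
Qed.

Lemma su2_mul1 (g : SU2pt) : su2_mul g su2_one = g.
Proof. destruct g as [[a b] [c d]]; apply SU2pt_ext; simpl; ring. Qed.

Lemma su2_1mul (g : SU2pt) : su2_mul su2_one g = g.
Proof. destruct g as [[a b] [c d]]; apply SU2pt_ext; simpl; ring. Qed.

Lemma expY_0 (j : dir) : expY j 0 = su2_one.
Proof.
destruct j; apply SU2pt_ext; simpl; replace (0 / 2) with 0 by field;
  rewrite ?cos_0, ?sin_0; reflexivity.
Qed.

Lemma expY_plus (j : dir) (s t : R) : expY j (s + t) = su2_mul (expY j s) (expY j t).
Proof.
destruct j; apply SU2pt_ext; simpl; replace ((s + t) / 2) with (s / 2 + t / 2) by field;
  rewrite ?cos_plus, ?sin_plus; ring.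
Qed.

Lemma expY0_4PI : expY D0 (4 * PI) = su2_one.
Proof.
unfold expY, su2_one, RtoC. replace (4 * PI / 2) with (2 * PI) by field.
rewrite cos_2PI, sin_2PI; reflexivity.
Qed.

(** * Componentwise calculus for complex-valued functions *)

(** Real and imaginary parts are kept apart here because [Xf] and [haar_int] are defined
    componentwise. *)
Definition Ccont {T : UniformSpace} (F : T -> C) (x : T) : Prop :=
  continuous (fun y => Re (F y)) x /\ continuous (fun y => Im (F y)) x.

Definition Cderiv (F : R -> C) (x : R) (l : C) : Prop :=
  is_derive (fun t => Re (F t)) x (Re l) /\ is_derive (fun t => Im (F t)) x (Im l).

Definition CRInt (F : R -> C) (a b : R) : C :=
  (RInt (fun t => Re (F t)) a b, RInt (fun t => Im (F t)) a b).

Section Ccont.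
Context {T : UniformSpace}.

Lemma Ccont_const (c : C) (x : T) : Ccont (fun _ => c) x.
Proof. split; apply continuous_const. Qed.

Lemma Ccont_plus (F G : T -> C) (x : T) : Ccont F x -> Ccont G x ->
  Ccont (fun y => Cplus (F y) (G y)) x.
Proof.
intros [F1 F2] [G1 G2]; split; simpl.
- apply (continuous_plus (fun y => Re (F y)) (fun y => Re (G y))); assumption.
- apply (continuous_plus (fun y => Im (F y)) (fun y => Im (G y))); assumption.
Qed.

Lemma Ccont_opp (F : T -> C) (x : T) : Ccont F x -> Ccont (fun y => Copp (F y)) x.
Proof.
intros [F1 F2]; split; simpl.
- apply (continuous_opp (fun y => Re (F y))); assumption.
- apply (continuous_opp (fun y => Im (F y))); assumption.
Qed.

Lemma Ccont_conj (F : T -> C) (x : T) : Ccont F x -> Ccont (fun y => Cconj (F y)) x.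
Proof.
intros [F1 F2]; split; simpl. assumption.
apply (continuous_opp (fun y => Im (F y))); assumption.
Qed.

Lemma Ccont_mult (F G : T -> C) (x : T) : Ccont F x -> Ccont G x ->
  Ccont (fun y => Cmult (F y) (G y)) x.
Proof.
intros [F1 F2] [G1 G2]; split; simpl.
- apply (continuous_minus (fun y => Re (F y) * Re (G y)) (fun y => Im (F y) * Im (G y)));
  [apply (continuous_mult (fun y => Re (F y)) (fun y => Re (G y)))
  |apply (continuous_mult (fun y => Im (F y)) (fun y => Im (G y)))]; assumption.
- apply (continuous_plus (fun y => Re (F y) * Im (G y)) (fun y => Im (F y) * Re (G y)));
  [apply (continuous_mult (fun y => Re (F y)) (fun y => Im (G y)))
  |apply (continuous_mult (fun y => Im (F y)) (fun y => Re (G y)))]; assumption.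
Qed.

Lemma Ccont_pair (f g : T -> R) (x : T) : continuous f x -> continuous g x ->
  Ccont (fun y => (f y, g y)) x.
Proof. split; assumption. Qed.

Lemma Ccont_comp {U : UniformSpace} (u : U -> T) (F : T -> C) (x : U) :
  continuous u x -> Ccont F (u x) -> Ccont (fun y => F (u y)) x.
Proof.
intros Hu [F1 F2]; split;
  [apply (continuous_comp u (fun y => Re (F y)))|apply (continuous_comp u (fun y => Im (F y)))];
  assumption.
Qed.

Lemma Ccont_ball (F : T -> C) (x : T) : Ccont F x -> forall eps, 0 < eps ->
  locally x (fun y => Cmod (Cminus (F y) (F x)) < eps).
Proof.
intros [F1 F2] eps He.
assert (He2 : 0 < eps / 2) by lra.
generalize (F1 _ (locally_ball _ (mkposreal _ He2))) (F2 _ (locally_ball _ (mkposreal _ He2))).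
unfold filtermap; intros H1 H2. generalize (filter_and _ _ H1 H2). apply filter_imp.
intros y [B1 B2].
change (Rabs (Re (F y) - Re (F x)) < eps / 2) in B1.
change (Rabs (Im (F y) - Im (F x)) < eps / 2) in B2.
replace eps with (2 * (eps / 2)) by field. apply Cmod_lt_2; assumption.
Qed.

Lemma Ccont_of_ball (F : T -> C) (x : T) : (forall eps, 0 < eps ->
  locally x (fun y => Cmod (Cminus (F y) (F x)) < eps)) -> Ccont F x.
Proof.
intros H; split; intros P [eps He]; unfold filtermap; generalize (H eps (cond_pos eps)); apply filter_imp;
  intros y Hy; apply He.
- change (Rabs (Re (F y) - Re (F x)) < eps).
  eapply Rle_lt_trans; [|exact Hy]. apply (re_le_Cmod (Cminus (F y) (F x))).
- change (Rabs (Im (F y) - Im (F x)) < eps).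
  eapply Rle_lt_trans; [|exact Hy]. apply (Im_le_Cmod (Cminus (F y) (F x))).
Qed.

Definition Pcont (gam : T -> SU2pt) (x : T) : Prop :=
  Ccont (fun y => fst (gam y)) x /\ Ccont (fun y => snd (gam y)) x.

(** [continuous_SU2] is continuity relative to the group; composing with a map that stays in the
    group turns it into ordinary continuity in the parameter. *)
Lemma continuous_SU2_comp (f : SU2pt -> C) (gam : T -> SU2pt) (x : T) :
  continuous_SU2 f -> (forall y, on_SU2 (gam y)) -> Pcont gam x ->
  Ccont (fun y => f (gam y)) x.
Proof.
intros Hf Hon [H1 H2]. apply Ccont_of_ball. intros eps He.
destruct (Hf (gam x) (Hon x) eps He) as [d [Hd H]].
generalize (filter_and _ _ (Ccont_ball _ _ H1 d Hd) (Ccont_ball _ _ H2 d Hd)).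
apply filter_imp. intros y [A B]. apply H; auto.
Qed.

Lemma Pcont_const (g : SU2pt) (x : T) : Pcont (fun _ => g) x.
Proof. split; apply Ccont_const. Qed.

Lemma Pcont_mul (g h : T -> SU2pt) (x : T) : Pcont g x -> Pcont h x ->
  Pcont (fun y => su2_mul (g y) (h y)) x.
Proof.
intros [g1 g2] [h1 h2].
split; simpl; auto using Ccont_plus, Ccont_mult, Ccont_opp, Ccont_conj.
Qed.

Lemma continuous_cos_half (u : T -> R) (x : T) : continuous u x ->
  continuous (fun y => cos (u y / 2)) x.
Proof.
intros H. apply (continuous_comp u (fun z => cos (z / 2))). exact H.
apply (ex_derive_continuous (fun z => cos (z / 2))). auto_derive; auto.
Qed.

Lemma continuous_sin_half (u : T -> R) (x : T) : continuous u x ->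
  continuous (fun y => sin (u y / 2)) x.
Proof.
intros H. apply (continuous_comp u (fun z => sin (z / 2))). exact H.
apply (ex_derive_continuous (fun z => sin (z / 2))). auto_derive; auto.
Qed.

Lemma Pcont_expY (j : dir) (u : T -> R) (x : T) : continuous u x ->
  Pcont (fun y => expY j (u y)) x.
Proof.
intros; split; destruct j; apply Ccont_pair;
  auto using continuous_cos_half, continuous_sin_half, continuous_const.
Qed.

End Ccont.

Lemma Cderiv_const (c : C) (x : R) : Cderiv (fun _ => c) x (RtoC 0).
Proof. split; apply (is_derive_const (V := R_NormedModule)). Qed.

Lemma Cderiv_plus (F G : R -> C) (x : R) (l m : C) : Cderiv F x l -> Cderiv G x m ->
  Cderiv (fun t => Cplus (F t) (G t)) x (Cplus l m).
Proof.
intros [F1 F2] [G1 G2]; split; simpl.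
- apply (is_derive_plus (fun y => Re (F y)) (fun y => Re (G y))); assumption.
- apply (is_derive_plus (fun y => Im (F y)) (fun y => Im (G y))); assumption.
Qed.

Lemma Cderiv_conj (F : R -> C) (x : R) (l : C) : Cderiv F x l ->
  Cderiv (fun t => Cconj (F t)) x (Cconj l).
Proof.
intros [F1 F2]; split; simpl. assumption.
apply (is_derive_opp (fun y => Im (F y))); assumption.
Qed.

Lemma is_derive_Rmult (f g : R -> R) (x a b c : R) : is_derive f x a -> is_derive g x b ->
  c = a * g x + f x * b -> is_derive (fun t => f t * g t) x c.
Proof.
intros H1 H2 ->. apply (is_derive_mult f g); auto. intros; apply Rmult_comm.
Qed.

Lemma Cderiv_mult (F G : R -> C) (x : R) (l m : C) : Cderiv F x l -> Cderiv G x m ->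
  Cderiv (fun t => Cmult (F t) (G t)) x (Cplus (Cmult l (G x)) (Cmult (F x) m)).
Proof.
intros [F1 F2] [G1 G2]; split; simpl.
- evar_last. apply (is_derive_minus (fun y => Re (F y) * Re (G y)) (fun y => Im (F y) * Im (G y)));
   eapply is_derive_Rmult; eauto.
  unfold minus, plus, opp, Re, Im; simpl; ring.
- evar_last. apply (is_derive_plus (fun y => Re (F y) * Im (G y)) (fun y => Im (F y) * Re (G y)));
   eapply is_derive_Rmult; eauto.
  unfold minus, plus, opp, Re, Im; simpl; ring.
Qed.

Lemma Cderiv_ext (F G : R -> C) (x : R) (l : C) : (forall t, F t = G t) ->
  Cderiv F x l -> Cderiv G x l.
Proof.
intros H [F1 F2]; split; [eapply is_derive_ext; [|exact F1]|eapply is_derive_ext; [|exact F2]];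
  simpl; intros; rewrite H; reflexivity.
Qed.

Lemma Cderiv_ext_loc (F G : R -> C) (x : R) (l : C) : locally x (fun t => F t = G t) ->
  Cderiv F x l -> Cderiv G x l.
Proof.
intros H [F1 F2]; split; [eapply is_derive_ext_loc; [|exact F1]|eapply is_derive_ext_loc; [|exact F2]];
  revert H; apply filter_imp; intros t E; rewrite E; reflexivity.
Qed.

Lemma Cderiv_Ccont (F : R -> C) (x : R) (l : C) : Cderiv F x l -> Ccont F x.
Proof.
intros [F1 F2]; split; apply (ex_derive_continuous (V := R_NormedModule));
  eexists; eassumption.
Qed.

Lemma Cderiv_shift (F : R -> C) (t : R) (l : C) : Cderiv (fun s => F (t + s)) 0 l -> Cderiv F t l.
Proof.
assert (K : forall (f : R -> R) l, is_derive (fun s => f (t + s)) 0 l -> is_derive f t l).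
{ clear. intros f l H.
  apply (is_derive_ext (fun s => (fun u => f (t + u)) (s - t))).
  intros s; f_equal; simpl; ring.
  evar_last. apply (is_derive_comp (fun u => f (t + u)) (fun s => s - t)).
  replace (t - t) with 0 by ring. exact H.
  auto_derive; auto. unfold scal; simpl; unfold mult; simpl; ring. }
intros [F1 F2]; split; [apply (K (fun s => Re (F s)))|apply (K (fun s => Im (F s)))]; assumption.
Qed.

(** * Left-invariant derivatives and smoothness *)

Definition is_Xf (j : dir) (f : SU2pt -> C) (g : SU2pt) (l : C) : Prop :=
  Cderiv (fun t => f (su2_mul g (expY j t))) 0 l.

Lemma is_Xf_unique (j : dir) (f : SU2pt -> C) (g : SU2pt) (l : C) : is_Xf j f g l -> Xf j f g = l.
Proof. intros [H1 H2]; apply C_ext; apply is_derive_unique; assumption. Qed.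

Lemma is_Xf_ex (j : dir) (f : SU2pt -> C) (g : SU2pt) (l : C) : is_Xf j f g l -> ex_Xf j f g.
Proof. intros [H1 H2]; split; eexists; eassumption. Qed.

Lemma Xf_correct (j : dir) (f : SU2pt -> C) (g : SU2pt) : ex_Xf j f g -> is_Xf j f g (Xf j f g).
Proof. intros [H1 H2]; split; apply Derive_correct; assumption. Qed.

Lemma is_Xf_ext (j : dir) (f1 f2 : SU2pt -> C) (g : SU2pt) (l : C) : on_SU2 g ->
  (forall h, on_SU2 h -> f1 h = f2 h) -> is_Xf j f1 g l -> is_Xf j f2 g l.
Proof.
intros Hg H; apply Cderiv_ext; intros t; apply H; auto using on_SU2_mul_exp.
Qed.

Lemma Xf_ext (j : dir) (f1 f2 : SU2pt -> C) (g : SU2pt) : on_SU2 g ->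
  (forall h, on_SU2 h -> f1 h = f2 h) -> Xf j f1 g = Xf j f2 g.
Proof.
intros Hg H. apply C_ext; apply Derive_ext; intros t;
 rewrite H; auto using on_SU2_mul_exp.
Qed.

Lemma Xs_ext (js : list dir) (f1 f2 : SU2pt -> C) : (forall h, on_SU2 h -> f1 h = f2 h) ->
  forall g, on_SU2 g -> Xs js f1 g = Xs js f2 g.
Proof. induction js; simpl; intros; auto. apply Xf_ext; auto. Qed.

Lemma continuous_SU2_ext (f1 f2 : SU2pt -> C) : (forall h, on_SU2 h -> f1 h = f2 h) ->
  continuous_SU2 f1 -> continuous_SU2 f2.
Proof.
intros H H1 g Hg eps He. destruct (H1 g Hg eps He) as [d [Hd K]].
exists d; split; auto. intros h Hh. rewrite <- !H by auto. auto.
Qed.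

(** Replaces the quantification over words [js] by a class of continuous functions stable under
    differentiation. The derivative [f'] has to agree with [Xf j f] on the group only, so it may be
    given by a closed formula. *)
Lemma smooth_coind (P : (SU2pt -> C) -> Prop) :
  (forall f, P f -> continuous_SU2 f /\ forall j, exists f', P f' /\
     forall g, on_SU2 g -> is_Xf j f g (f' g)) ->
  forall f, P f -> smooth f.
Proof.
intros H f Pf js.
assert (K : exists f', P f' /\ forall g, on_SU2 g -> f' g = Xs js f g).
{ induction js as [|j js [f' [Pf' IH]]]. exists f; auto.
  destruct (H f' Pf') as [_ H2]. destruct (H2 j) as [f'' [P2 E]].
  exists f''; split; auto. intros g Hg. simpl.
  rewrite <- (Xf_ext j f' (Xs js f) g Hg IH). symmetry. apply is_Xf_unique; auto. }
destruct K as [f' [Pf' E]]. destruct (H f' Pf') as [Hc H2]. split.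
apply (continuous_SU2_ext f'); auto.
intros j g Hg. destruct (H2 j) as [f'' [P2 E2]].
eapply is_Xf_ex, is_Xf_ext; eauto.
Qed.

Lemma smooth_continuous (f : SU2pt -> C) : smooth f -> continuous_SU2 f.
Proof. intros H; apply (H nil). Qed.

Lemma smooth_is_Xf (f : SU2pt -> C) (j : dir) (g : SU2pt) : smooth f -> on_SU2 g ->
  is_Xf j f g (Xf j f g).
Proof. intros H Hg; apply Xf_correct, (H nil); auto. Qed.

Lemma Xs_app (js js' : list dir) (f : SU2pt -> C) : Xs (js ++ js') f = Xs js (Xs js' f).
Proof. induction js; simpl; congruence. Qed.

Lemma smooth_Xf (f : SU2pt -> C) (j : dir) : smooth f -> smooth (Xf j f).
Proof. intros H js. specialize (H (js ++ j :: nil)). rewrite Xs_app in H. exact H. Qed.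

Lemma is_Xf_plus (j : dir) (f1 f2 : SU2pt -> C) (g : SU2pt) (l m : C) :
  is_Xf j f1 g l -> is_Xf j f2 g m -> is_Xf j (fun g => Cplus (f1 g) (f2 g)) g (Cplus l m).
Proof. apply Cderiv_plus. Qed.

Lemma is_Xf_conj (j : dir) (f : SU2pt -> C) (g : SU2pt) (l : C) :
  is_Xf j f g l -> is_Xf j (fun g => Cconj (f g)) g (Cconj l).
Proof. apply Cderiv_conj. Qed.

Lemma is_Xf_mult (j : dir) (f1 f2 : SU2pt -> C) (g : SU2pt) (l m : C) :
  is_Xf j f1 g l -> is_Xf j f2 g m ->
  is_Xf j (fun g => Cmult (f1 g) (f2 g)) g (Cplus (Cmult l (f2 g)) (Cmult (f1 g) m)).
Proof.
intros H1 H2. generalize (Cderiv_mult _ _ _ _ _ H1 H2). cbv beta.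
rewrite expY_0, su2_mul1. auto.
Qed.

Lemma is_Xf_scal (j : dir) (c : C) (f : SU2pt -> C) (g : SU2pt) (l : C) :
  is_Xf j f g l -> is_Xf j (fun g => Cmult c (f g)) g (Cmult c l).
Proof.
intros H. replace (Cmult c l) with (Cplus (Cmult (RtoC 0) (f g)) (Cmult c l)) by ring.
apply (is_Xf_mult j (fun _ => c) f); auto. apply Cderiv_const.
Qed.

Lemma continuous_SU2_plus (f1 f2 : SU2pt -> C) : continuous_SU2 f1 -> continuous_SU2 f2 ->
  continuous_SU2 (fun g => Cplus (f1 g) (f2 g)).
Proof.
intros H1 H2 g Hg eps He.
destruct (H1 g Hg (eps / 2) ltac:(lra)) as [d1 [D1 K1]].
destruct (H2 g Hg (eps / 2) ltac:(lra)) as [d2 [D2 K2]].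
exists (Rmin d1 d2); split. apply Rmin_glb_lt; auto.
intros h Hh A B.
replace (Cminus _ _) with (Cplus (Cminus (f1 h) (f1 g)) (Cminus (f2 h) (f2 g))) by ring.
eapply Rle_lt_trans. apply Cmod_triangle.
assert (Cmod (Cminus (f1 h) (f1 g)) < eps / 2).
{ apply K1; auto; eapply Rlt_le_trans; eauto; apply Rmin_l. }
assert (Cmod (Cminus (f2 h) (f2 g)) < eps / 2).
{ apply K2; auto; eapply Rlt_le_trans; eauto; apply Rmin_r. }
lra.
Qed.

Lemma continuous_SU2_const (c : C) : continuous_SU2 (fun _ => c).
Proof.
intros g Hg eps He. exists 1; split; [lra|]. intros.
replace (Cminus c c) with (RtoC 0) by ring. rewrite Cmod_0; lra.
Qed.

Lemma continuous_SU2_conj (f : SU2pt -> C) : continuous_SU2 f ->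
  continuous_SU2 (fun g => Cconj (f g)).
Proof.
intros H g Hg eps He. destruct (H g Hg eps He) as [d [Hd K]]. exists d; split; auto.
intros h Hh A B. rewrite <- Cminus_conj, Cmod_conj. auto.
Qed.

Lemma continuous_SU2_mult (f1 f2 : SU2pt -> C) : continuous_SU2 f1 -> continuous_SU2 f2 ->
  continuous_SU2 (fun g => Cmult (f1 g) (f2 g)).
Proof.
intros H1 H2 g Hg eps He.
set (M := 1 + Cmod (f1 g) + Cmod (f2 g)).
assert (P1 := Cmod_ge_0 (f1 g)). assert (P2 := Cmod_ge_0 (f2 g)).
assert (HM : 1 <= M) by (unfold M; lra).
set (e := Rmin 1 (eps / (2 * M))).
assert (Hee : 0 < eps / (2 * M)) by (apply Rdiv_lt_0_compat; lra).
assert (Hep : 0 < e) by (unfold e; apply Rmin_glb_lt; lra).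
assert (e1 : e <= 1) by apply Rmin_l.
assert (e2 : e * M <= eps / 2).
{ apply Rle_trans with (eps / (2 * M) * M). apply Rmult_le_compat_r. lra. apply Rmin_r.
  right; field; lra. }
destruct (H1 g Hg e Hep) as [d1 [D1 K1]].
destruct (H2 g Hg e Hep) as [d2 [D2 K2]].
exists (Rmin d1 d2); split. apply Rmin_glb_lt; auto.
intros h Hh A B.
assert (L1 : Cmod (Cminus (f1 h) (f1 g)) < e).
{ apply K1; auto; eapply Rlt_le_trans; eauto; apply Rmin_l. }
assert (L2 : Cmod (Cminus (f2 h) (f2 g)) < e).
{ apply K2; auto; eapply Rlt_le_trans; eauto; apply Rmin_r. }
replace (Cminus _ _) with (Cplus (Cplus (Cmult (Cminus (f1 h) (f1 g)) (Cminus (f2 h) (f2 g)))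
   (Cmult (Cminus (f1 h) (f1 g)) (f2 g))) (Cmult (f1 g) (Cminus (f2 h) (f2 g)))) by ring.
eapply Rle_lt_trans. apply Cmod_triangle.
eapply Rle_lt_trans. apply Rplus_le_compat_r, Cmod_triangle.
rewrite !Cmod_mult.
assert (Q1 := Cmod_ge_0 (Cminus (f1 h) (f1 g))). assert (Q2 := Cmod_ge_0 (Cminus (f2 h) (f2 g))).
unfold M in e2. nra.
Qed.

Lemma smooth_const (c : C) : smooth (fun _ => c).
Proof.
apply (smooth_coind (fun f => exists c, f = fun _ => c)); [|eauto].
intros f [k ->]; split. apply continuous_SU2_const.
intros j; exists (fun _ => RtoC 0); split; eauto. intros; apply Cderiv_const.
Qed.

Lemma smooth_plus (f1 f2 : SU2pt -> C) : smooth f1 -> smooth f2 ->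
  smooth (fun g => Cplus (f1 g) (f2 g)).
Proof.
intros H1 H2.
apply (smooth_coind (fun f => exists f1 f2, smooth f1 /\ smooth f2 /\ f = fun g => Cplus (f1 g) (f2 g)));
  [|exists f1, f2; auto].
clear. intros f (f1 & f2 & H1 & H2 & ->); split.
apply continuous_SU2_plus; auto using smooth_continuous.
intros j; exists (fun g => Cplus (Xf j f1 g) (Xf j f2 g)); split.
exists (Xf j f1), (Xf j f2); auto using smooth_Xf.
intros; apply is_Xf_plus; auto using smooth_is_Xf.
Qed.

Lemma smooth_conj (f : SU2pt -> C) : smooth f -> smooth (fun g => Cconj (f g)).
Proof.
intros H.
apply (smooth_coind (fun f => exists f1, smooth f1 /\ f = fun g => Cconj (f1 g)));
  [|exists f; auto].
clear. intros f (f1 & H1 & ->); split.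
apply continuous_SU2_conj; auto using smooth_continuous.
intros j; exists (fun g => Cconj (Xf j f1 g)); split.
exists (Xf j f1); auto using smooth_Xf.
intros; apply is_Xf_conj; auto using smooth_is_Xf.
Qed.

Lemma smooth_scal (c : C) (f : SU2pt -> C) : smooth f -> smooth (fun g => Cmult c (f g)).
Proof.
intros H.
apply (smooth_coind (fun f => exists f1, smooth f1 /\ f = fun g => Cmult c (f1 g)));
  [|exists f; auto].
clear. intros f (f1 & H1 & ->); split.
apply (continuous_SU2_mult (fun _ => c)); auto using smooth_continuous, continuous_SU2_const.
intros j; exists (fun g => Cmult c (Xf j f1 g)); split.
exists (Xf j f1); auto using smooth_Xf.
intros; apply is_Xf_scal; auto using smooth_is_Xf.
Qed.

(** [Xf] differentiates at parameter 0; the subgroup law [expY_plus] moves the base point along the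
    orbit. *)
Lemma Cderiv_orbit (f : SU2pt -> C) (j : dir) (g : SU2pt) (t : R) : smooth f -> on_SU2 g ->
  Cderiv (fun t => f (su2_mul g (expY j t))) t (Xf j f (su2_mul g (expY j t))).
Proof.
intros Hf Hg. apply Cderiv_shift.
eapply Cderiv_ext; [|apply (smooth_is_Xf f j (su2_mul g (expY j t)));
  auto using on_SU2_mul_exp].
intros s; simpl. rewrite expY_plus, su2_mulA; reflexivity.
Qed.

(** * Compactness of the group *)

(** Compactness of the cube in four real dimensions requires a radius at every tag. A tag off the
    sphere receives one so small that no point of the group is close to it, which rules it out
    below. *)
Lemma sphere_complement_open (a b c d : R) : a * a + b * b + (c * c + d * d) <> 1 ->
  exists e, 0 < e /\ forall x y z t, x * x + y * y + (z * z + t * t) = 1 ->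
    Rabs (x - a) < e -> Rabs (y - b) < e -> Rabs (z - c) < e -> Rabs (t - d) < e -> False.
Proof.
intros H.
assert (Hn : 0 < Rabs (a * a + b * b + (c * c + d * d) - 1)) by (apply Rabs_pos_lt; lra).
set (n := Rabs _) in Hn.
set (B := Rabs a + Rabs b + Rabs c + Rabs d).
assert (HB : 0 <= B).
{ unfold B; generalize (Rabs_pos a) (Rabs_pos b) (Rabs_pos c) (Rabs_pos d); lra. }
(* A perturbation below [e <= 1] changes the squared norm by at most [e * (2 * B + 4)]; the 5 makes
   this strictly less than [n]. *)
set (e := Rmin 1 (n / (2 * B + 5))).
assert (Hq : 0 < n / (2 * B + 5)) by (apply Rdiv_lt_0_compat; lra).
assert (He : 0 < e) by (apply Rmin_glb_lt; lra).
assert (He1 : e <= 1) by apply Rmin_l.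
assert (He2 : e * (2 * B + 5) <= n).
{ apply Rle_trans with (n / (2 * B + 5) * (2 * B + 5)).
  apply Rmult_le_compat_r; [lra|apply Rmin_r]. right; field; lra. }
exists e; split; auto. intros x y z t Hx H1 H2 H3 H4.
assert (K : forall u v, Rabs (u - v) < e -> Rabs (v * v - u * u) <= e * (2 * Rabs v + 1)).
{ intros u v Hu. replace (v * v - u * u) with ((u - v) * (- (u - v) - 2 * v)) by ring.
  rewrite Rabs_mult. apply Rmult_le_compat; try apply Rabs_pos. lra.
  eapply Rle_trans. apply Rabs_triang. rewrite !Rabs_Ropp, Rabs_mult, (Rabs_right 2); lra. }
apply K in H1. apply K in H2. apply K in H3. apply K in H4.
assert (n <= e * (2 * B + 4)).
{ unfold n. rewrite <- Hx.
  replace (a * a + b * b + (c * c + d * d) - (x * x + y * y + (z * z + t * t)))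
   with ((a * a - x * x) + (b * b - y * y) + ((c * c - z * z) + (d * d - t * t))) by ring.
  eapply Rle_trans. apply Rabs_triang.
  eapply Rle_trans. apply Rplus_le_compat; apply Rabs_triang. unfold B. lra. }
lra.
Qed.

(** Read [P t d] as saying that [d] is an admissible radius at [t]. The radii are chosen pointwise,
    and the conclusion bounds from below the radius of some tag near each [x], as a Lebesgue number
    does. *)
Lemma SU2_lebesgue_number (P : SU2pt -> R -> Prop) :
  (forall t, on_SU2 t -> exists d, 0 < d /\ P t d) ->
  exists d, 0 < d /\ forall x, on_SU2 x -> exists t e, on_SU2 t /\ P t e /\ d <= e /\
    Cmod (Cminus (fst x) (fst t)) < 2 * e /\ Cmod (Cminus (snd x) (snd t)) < 2 * e.
Proof.
intros HP.
set (pt := fun t : Compactness.Tn 4 R =>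
  (((fst t, fst (snd t)), (fst (snd (snd t)), fst (snd (snd (snd t))))) : SU2pt)).
assert (ch : forall t : Compactness.Tn 4 R, exists e : posreal,
  (on_SU2 (pt t) -> P (pt t) e) /\
  (~ on_SU2 (pt t) -> forall x : Compactness.Tn 4 R, on_SU2 (pt x) -> ~ close_n 4 e x t)).
{ intros t. destruct (classic (on_SU2 (pt t))) as [H|H].
  - destruct (HP _ H) as [d [Hd Pd]]. exists (mkposreal d Hd); split; tauto.
  - assert (H' := H). rewrite on_SU2_coord in H'.
    destruct (sphere_complement_open _ _ _ _ H') as [e [He K]].
    exists (mkposreal e He); split; [tauto|]. intros _ x Hx.
    apply on_SU2_coord in Hx.
    destruct x as (x1 & x2 & x3 & x4 & x5), t as (t1 & t2 & t3 & t4 & t5); simpl in *.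
    intros (C1 & C2 & C3 & C4 & _). eapply K; eauto. }
destruct (choice _ ch) as [delta Hdelta].
destruct (compactness_value 4 (-1, (-1, (-1, (-1, tt)))) (1, (1, (1, (1, tt)))) delta) as [d Hd].
exists d; split; [apply cond_pos|]. intros x Hx.
set (xt := (fst (fst x), (snd (fst x), (fst (snd x), (snd (snd x), tt)))) : Compactness.Tn 4 R).
assert (Hb : bounded_n 4 (-1, (-1, (-1, (-1, tt)))) (1, (1, (1, (1, tt)))) xt).
{ apply on_SU2_coord in Hx. destruct x as [[x1 x2] [x3 x4]]; simpl in *.
  repeat split; nra. }
generalize (NNPP _ (Hd xt Hb)). intros [t (_ & Hc & Hdt)].
destruct (Hdelta t) as [G1 G2].
destruct (classic (on_SU2 (pt t))) as [H|H].
2: { exfalso. apply (G2 H xt); auto. }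
exists (pt t), (delta t). split; [auto|split; [auto|split; [auto|]]].
destruct x as [[x1 x2] [x3 x4]], t as (t1 & t2 & t3 & t4 & t5).
simpl in Hc. destruct Hc as (C1 & C2 & C3 & C4 & _).
split; apply Cmod_lt_2; simpl; assumption.
Qed.

Lemma continuous_SU2_unif (f : SU2pt -> C) : continuous_SU2 f -> forall eps, 0 < eps ->
  exists d, 0 < d /\ forall g h, on_SU2 g -> on_SU2 h ->
    Cmod (Cminus (fst h) (fst g)) < d -> Cmod (Cminus (snd h) (snd g)) < d ->
    Cmod (Cminus (f h) (f g)) < eps.
Proof.
intros Hf eps He.
(* The factor 3 is needed because [g] lies within [2 * e] of the tag and [h] within [d <= e] of
   [g]. *)
destruct (SU2_lebesgue_number (fun t d => forall h, on_SU2 h ->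
  Cmod (Cminus (fst h) (fst t)) < 3 * d -> Cmod (Cminus (snd h) (snd t)) < 3 * d ->
  Cmod (Cminus (f h) (f t)) < eps / 2)) as [d [Hd K]].
{ intros t Ht. destruct (Hf t Ht (eps / 2) ltac:(lra)) as [d [Hd H]].
  exists (d / 3); split; [lra|]. intros; apply H; auto; lra. }
exists d; split; auto. intros g h Hg Hh A B.
destruct (K g Hg) as (t & e & Ht & HP & de & Q1 & Q2).
assert (R1 : Cmod (Cminus (f g) (f t)) < eps / 2) by (apply HP; auto; lra).
assert (R2 : Cmod (Cminus (f h) (f t)) < eps / 2).
{ apply HP; auto.
  - replace (Cminus (fst h) (fst t)) with
      (Cplus (Cminus (fst h) (fst g)) (Cminus (fst g) (fst t))) by ring.
    eapply Rle_lt_trans; [apply Cmod_triangle|lra].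
  - replace (Cminus (snd h) (snd t)) with
      (Cplus (Cminus (snd h) (snd g)) (Cminus (snd g) (snd t))) by ring.
    eapply Rle_lt_trans; [apply Cmod_triangle|lra]. }
replace (Cminus (f h) (f g)) with
  (Cplus (Cminus (f h) (f t)) (Copp (Cminus (f g) (f t)))) by ring.
eapply Rle_lt_trans; [apply Cmod_triangle|rewrite Cmod_opp; lra].
Qed.

Lemma continuous_SU2_bounded (f : SU2pt -> C) : continuous_SU2 f ->
  exists M, 0 < M /\ forall g, on_SU2 g -> Cmod (f g) <= M.
Proof.
intros Hf.
(* Shrinking the radius at [t] below [/ (1 + |f t|)] turns the uniform lower
   bound on the radii into an upper bound on [|f|]. *)
destruct (SU2_lebesgue_number (fun t d => d <= / (1 + Cmod (f t)) /\ forall h, on_SU2 h ->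
  Cmod (Cminus (fst h) (fst t)) < 2 * d -> Cmod (Cminus (snd h) (snd t)) < 2 * d ->
  Cmod (Cminus (f h) (f t)) < 1)) as [d [Hd K]].
{ intros t Ht. destruct (Hf t Ht 1 ltac:(lra)) as [d [Hd H]].
  assert (P := Cmod_ge_0 (f t)).
  assert (P' : 0 < / (1 + Cmod (f t))) by (apply Rinv_0_lt_compat; lra).
  exists (Rmin (d / 2) (/ (1 + Cmod (f t)))); split; [apply Rmin_glb_lt; lra|].
  assert (L := Rmin_l (d / 2) (/ (1 + Cmod (f t)))).
  split; [apply Rmin_r|]. intros; apply H; auto; lra. }
exists (/ d + 1). assert (0 < / d) by (apply Rinv_0_lt_compat; lra). split; [lra|].
intros g Hg. destruct (K g Hg) as (t & e & Ht & [HP1 HP2] & de & Q1 & Q2).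
assert (R1 : Cmod (Cminus (f g) (f t)) < 1) by (apply HP2; auto).
assert (P := Cmod_ge_0 (f t)).
assert (1 + Cmod (f t) <= / d).
{ rewrite <- (Rinv_inv (1 + Cmod (f t))). apply Rinv_le_contravar; lra. }
replace (f g) with (Cplus (Cminus (f g) (f t)) (f t)) by ring.
eapply Rle_trans; [apply Cmod_triangle|lra].
Qed.

(** * Derivatives in rotated directions *)

(** Only differentiability in the second variable is assumed, so the increment is taken at fixed
    [s]: the mean value theorem writes it as [dphi s xi * al s], and joint continuity of [dphi]
    sends the first factor to [dphi 0 0]. *)
Lemma is_derive_increment (phi dphi : R -> R -> R) (al : R -> R) (a : R) :
  (forall s x, is_derive (phi s) x (dphi s x)) ->
  continuous (fun z : R * R => dphi (fst z) (snd z)) (0, 0) ->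
  al 0 = 0 -> is_derive al 0 a ->
  is_derive (fun s => phi s (al s) - phi s 0) 0 (a * dphi 0 0).
Proof.
intros Hd Hc al0 Hal.
apply is_derive_Reals. apply is_derive_Reals in Hal.
intros eps He.
set (N := Rabs (dphi 0 0)). assert (HN : 0 <= N) by apply Rabs_pos.
assert (Ha := Rabs_pos a).
(* The error at the end is at most [e1 * (Rabs a + 1) + N * e1]. *)
set (e1 := Rmin 1 (eps / (2 * (Rabs a + 1 + N)))).
assert (Hq : 0 < eps / (2 * (Rabs a + 1 + N))) by (apply Rdiv_lt_0_compat; lra).
assert (He1 : 0 < e1) by (apply Rmin_glb_lt; lra).
assert (He1' : e1 <= 1) by apply Rmin_l.
assert (He2 : e1 * (Rabs a + 1 + N) <= eps / 2).
{ apply Rle_trans with (eps / (2 * (Rabs a + 1 + N)) * (Rabs a + 1 + N)).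
  apply Rmult_le_compat_r; [lra|apply Rmin_r]. right; field; lra. }
destruct (Hc _ (locally_ball _ (mkposreal _ He1))) as [d1 Hd1].
destruct (Hal e1 He1) as [d2 Hd2].
assert (Hd1p := cond_pos d1). assert (Hd2p := cond_pos d2).
(* Since [Rabs (al h) <= (Rabs a + 1) * Rabs h], this radius keeps both [h] and the intermediate
   point [xi] below [d1]. *)
assert (Hq1 : 0 < d1 / (Rabs a + 2)) by (apply Rdiv_lt_0_compat; lra).
assert (Hq2 : d1 / (Rabs a + 2) * (Rabs a + 2) = d1) by (field; lra).
assert (Hdel : 0 < Rmin d2 (d1 / (Rabs a + 2))) by (apply Rmin_glb_lt; lra).
exists (mkposreal _ Hdel). intros h Hh0 Hh. simpl in Hh.
assert (L1 : Rabs h < d2) by (eapply Rlt_le_trans; [exact Hh|apply Rmin_l]).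
assert (L2 : Rabs h < d1 / (Rabs a + 2)) by (eapply Rlt_le_trans; [exact Hh|apply Rmin_r]).
specialize (Hd2 h Hh0 L1). rewrite Rplus_0_l, al0, Rminus_0_r in Hd2.
assert (Q : Rabs (al h / h) <= Rabs a + 1).
{ replace (al h / h) with ((al h / h - a) + a) by ring.
  eapply Rle_trans; [apply Rabs_triang|lra]. }
assert (Hah : Rabs (al h) < d1).
{ replace (al h) with (al h / h * h) by (field; auto). rewrite Rabs_mult.
  assert (Hp := Rabs_pos h). assert (Hpp := Rabs_pos (al h / h)). nra. }
assert (Hhd : Rabs h < d1).
{ assert (Hp := Rabs_pos h). nra. }
destruct (MVT_gen (phi h) 0 (al h) (dphi h)) as [xi [Hxi E]].
{ intros; apply Hd. }
{ intros x _. apply derivable_continuous_pt. exists (dphi h x). apply is_derive_Reals, Hd. }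
assert (Hx : Rabs xi < d1).
{ apply Rabs_def2 in Hah. apply Rabs_def1; unfold Rmin, Rmax in Hxi;
  destruct (Rle_dec 0 (al h)); lra. }
assert (B : Rabs (dphi h xi - dphi 0 0) < e1).
{ apply (Hd1 (h, xi)). split; simpl.
  - change (Rabs (h - 0) < d1). rewrite Rminus_0_r; auto.
  - change (Rabs (xi - 0) < d1). rewrite Rminus_0_r; auto. }
rewrite Rplus_0_l, al0, E.
replace ((dphi h xi * (al h - 0) - (phi 0 0 - phi 0 0)) / h - a * dphi 0 0) with
  ((dphi h xi - dphi 0 0) * (al h / h) + dphi 0 0 * (al h / h - a)) by (field; auto).
eapply Rle_lt_trans. apply Rabs_triang. rewrite !Rabs_mult. fold N.
assert (Hpp := Rabs_pos (al h / h)).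
assert (Hpp2 := Rabs_pos (dphi h xi - dphi 0 0)).
assert (Hpp3 := Rabs_pos (al h / h - a)).
apply Rle_lt_trans with (e1 * (Rabs a + 1) + N * e1); [|lra].
apply Rplus_le_compat; apply Rmult_le_compat; lra.
Qed.

(** One term of the telescoping sum for a product of one-parameter factors. The earlier factors
    [k s] need only be continuous: to first order, the last factor contributes as if they stood
    still at the unit. *)
Lemma Cderiv_increment (f : SU2pt -> C) (j : dir) (g : SU2pt) (k : R -> SU2pt)
    (al : R -> R) (a : R) :
  smooth f -> on_SU2 g -> (forall s, on_SU2 (k s)) -> k 0 = su2_one ->
  Pcont k 0 ->
  al 0 = 0 -> is_derive al 0 a ->
  Cderiv (fun s => Cminus (f (su2_mul (su2_mul g (k s)) (expY j (al s)))) (f (su2_mul g (k s))))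
    0 (Cmult (RtoC a) (Xf j f g)).
Proof.
intros Hf Hg Hk k0 Hk1 al0 Hal.
assert (Hon : forall s x, on_SU2 (su2_mul (su2_mul g (k s)) (expY j x)))
  by auto using on_SU2_mul_exp, on_SU2_mul.
assert (HC : Ccont (fun z : R * R => Xf j f (su2_mul (su2_mul g (k (fst z))) (expY j (snd z)))) (0, 0)).
{ apply continuous_SU2_comp; [apply smooth_continuous, smooth_Xf; auto|intros; apply Hon|].
  apply Pcont_mul; [apply Pcont_mul; [apply Pcont_const|]|apply Pcont_expY, continuous_snd].
  destruct Hk1 as [K1 K2].
  split; [apply (Ccont_comp fst (fun s => fst (k s)))|apply (Ccont_comp fst (fun s => snd (k s)))];
    try apply continuous_fst; assumption. }
assert (E0 : su2_mul (su2_mul g (k 0)) (expY j 0) = g) by (rewrite k0, expY_0, !su2_mul1; auto).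
assert (HD : forall s x, Cderiv (fun t => f (su2_mul (su2_mul g (k s)) (expY j t))) x
   (Xf j f (su2_mul (su2_mul g (k s)) (expY j x)))).
{ intros; apply Cderiv_orbit; auto using on_SU2_mul. }
split.
- evar_last. eapply is_derive_ext; [|apply (is_derive_increment
   (fun s x => Re (f (su2_mul (su2_mul g (k s)) (expY j x))))
   (fun s x => Re (Xf j f (su2_mul (su2_mul g (k s)) (expY j x)))) al a)]; auto.
  + intros s; simpl. rewrite expY_0, su2_mul1. reflexivity.
  + intros s x; apply (HD s x).
  + apply HC.
  + cbv beta. rewrite E0. simpl. unfold Re, Im. ring.
- evar_last. eapply is_derive_ext; [|apply (is_derive_increment
   (fun s x => Im (f (su2_mul (su2_mul g (k s)) (expY j x))))
   (fun s x => Im (Xf j f (su2_mul (su2_mul g (k s)) (expY j x)))) al a)]; auto.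
  + intros s; simpl. rewrite expY_0, su2_mul1. reflexivity.
  + intros s x; apply (HD s x).
  + apply HC.
  + cbv beta. rewrite E0. simpl. unfold Re, Im. ring.
Qed.

(* The one-parameter subgroup generated by [cos tau Y1 + sin tau Y2]. *)
Definition expYrot (tau s : R) : SU2pt :=
  (RtoC (cos (s / 2)), (cos tau * sin (s / 2), sin tau * sin (s / 2))).

(* Coordinates in which
     expYrot tau s = expY D1 rot_al * expY D2 rot_be * expY D0 rot_ga
   for small [s]: [rot_al] is the angle for which the two entries of
   [expY D1 (- rot_al) * expYrot tau s] have a purely imaginary ratio, and
   [rot_re + i rot_im] is the first of these entries. *)
Definition rot_al (tau s : R) : R := atan (cos tau * tan s).
Definition rot_re (tau s : R) : R :=
  cos (rot_al tau s / 2) * cos (s / 2) + sin (rot_al tau s / 2) * sin (s / 2) * cos tau.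
Definition rot_im (tau s : R) : R := sin (rot_al tau s / 2) * sin (s / 2) * sin tau.
Definition rot_be (tau s : R) : R :=
  2 * atan (sin tau * sin (s / 2) * cos (s / 2) / (rot_re tau s ^ 2 + rot_im tau s ^ 2)).
Definition rot_ga (tau s : R) : R := 2 * atan (rot_im tau s / rot_re tau s).

Lemma rot_al_0 tau : rot_al tau 0 = 0.
Proof. unfold rot_al. rewrite tan_0, Rmult_0_r, atan_0. reflexivity. Qed.

Lemma rot_re_0 tau : rot_re tau 0 = 1.
Proof.
unfold rot_re. rewrite rot_al_0. replace (0 / 2) with 0 by field.
rewrite cos_0, sin_0. ring.
Qed.

Lemma rot_im_0 tau : rot_im tau 0 = 0.
Proof.
unfold rot_im. rewrite rot_al_0. replace (0 / 2) with 0 by field. rewrite sin_0. ring.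
Qed.

(** The derivatives at 0 of [rot_al], [rot_be] and [rot_ga] are [cos tau], [sin tau] and 0, the
    components of [cos tau Y1 + sin tau Y2]. *)
Lemma is_derive_rot_al tau : is_derive (rot_al tau) 0 (cos tau).
Proof.
assert (H : is_derive tan 0 (tan 0 ^ 2 + 1)) by (apply is_derive_tan; rewrite cos_0; lra).
unfold rot_al. auto_derive.
- eexists; exact H.
- replace (Derive (fun x : R => tan x) 0) with (tan 0 ^ 2 + 1)
   by (symmetry; apply is_derive_unique; exact H).
  rewrite tan_0. field.
Qed.

Lemma is_derive_rot_re tau : is_derive (rot_re tau) 0 0.
Proof.
assert (H := is_derive_rot_al tau).
unfold rot_re. auto_derive. repeat split; eexists; exact H.
replace (Derive (fun x : R => rot_al tau x) 0) with (cos tau)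
   by (symmetry; apply is_derive_unique; exact H).
  rewrite rot_al_0.
replace (0 * / 2) with 0 by field. rewrite ?sin_0, ?cos_0. ring.
Qed.

Lemma is_derive_rot_im tau : is_derive (rot_im tau) 0 0.
Proof.
assert (H := is_derive_rot_al tau).
unfold rot_im. auto_derive. repeat split; eexists; exact H.
replace (Derive (fun x : R => rot_al tau x) 0) with (cos tau)
   by (symmetry; apply is_derive_unique; exact H).
  rewrite rot_al_0.
replace (0 * / 2) with 0 by field. rewrite ?sin_0, ?cos_0. ring.
Qed.

Lemma is_derive_rot_be tau : is_derive (rot_be tau) 0 (sin tau).
Proof.
assert (H := is_derive_rot_re tau). assert (H' := is_derive_rot_im tau).
unfold rot_be. auto_derive.
- repeat split; try (eexists; eassumption). rewrite rot_re_0, rot_im_0. lra.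
- replace (Derive (fun x : R => rot_re tau x) 0) with 0
   by (symmetry; apply is_derive_unique; exact H).
  replace (Derive (fun x : R => rot_im tau x) 0) with 0
   by (symmetry; apply is_derive_unique; exact H').
  rewrite rot_re_0, rot_im_0. replace (0 * / 2) with 0 by field. rewrite ?sin_0, ?cos_0.
  field.
Qed.

Lemma is_derive_rot_ga tau : is_derive (rot_ga tau) 0 0.
Proof.
assert (H := is_derive_rot_re tau). assert (H' := is_derive_rot_im tau).
unfold rot_ga. auto_derive.
- repeat split; try (eexists; eassumption). rewrite rot_re_0. lra.
- replace (Derive (fun x : R => rot_re tau x) 0) with 0
   by (symmetry; apply is_derive_unique; exact H).
  replace (Derive (fun x : R => rot_im tau x) 0) with 0
   by (symmetry; apply is_derive_unique; exact H').
  rewrite rot_re_0, rot_im_0. field.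
Qed.

Lemma rot_be_0 tau : rot_be tau 0 = 0.
Proof.
unfold rot_be. replace (0 / 2) with 0 by field. rewrite sin_0.
replace (_ / _) with 0. rewrite atan_0; ring.
unfold Rdiv; ring.
Qed.

Lemma rot_ga_0 tau : rot_ga tau 0 = 0.
Proof.
unfold rot_ga. rewrite rot_im_0. replace (0 / _) with 0 by (unfold Rdiv; ring).
rewrite atan_0; ring.
Qed.

(** Let [z = A + i B] and [w] be the entries of [expY D1 (- al) * expYrot tau s]. The choice of [al]
    makes [w = i Y z] with [Y] real, which is the shape of [expY D2 be * expY D0 ga]: [be / 2] is
    the arctangent of [Y] and [ga / 2] the argument of [z]. Positivity of [A] lets the arctangent of
    [B / A] recover that argument. *)
Lemma expYrot_decomp (tau s : R) : 0 < cos s -> 0 < rot_re tau s ->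
  expYrot tau s = su2_mul (su2_mul (expY D1 (rot_al tau s)) (expY D2 (rot_be tau s)))
                          (expY D0 (rot_ga tau s)).
Proof.
intros Hs HA.
set (al := rot_al tau s).
(* This is [tan al = cos tau * tan s] without denominators; written in half angles it becomes
   [M0]. *)
assert (Hal : sin al * cos s = cos al * cos tau * sin s).
{ unfold al, rot_al. rewrite sin_atan, cos_atan. unfold tan.
  assert (0 < sqrt (1 + (cos tau * (sin s / cos s))²)).
  { apply sqrt_lt_R0. generalize (Rle_0_sqr (cos tau * (sin s / cos s))). lra. }
  field. split; lra. }
assert (E1 := sin2_cos2_mul (al / 2)). assert (E2 := sin2_cos2_mul (s / 2)).
assert (E3 := sin2_cos2_mul tau).
replace al with (2 * (al / 2)) in Hal by field.
replace s with (2 * (s / 2)) in Hal by field.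
rewrite !sin_2a, !cos_2a in Hal.
set (A := rot_re tau s). set (B := rot_im tau s).
assert (EA : A = cos (al / 2) * cos (s / 2) + sin (al / 2) * sin (s / 2) * cos tau) by reflexivity.
assert (EB : B = sin (al / 2) * sin (s / 2) * sin tau) by reflexivity.
assert (Eg : rot_ga tau s = 2 * atan (B / A)) by reflexivity.
assert (Eb : rot_be tau s = 2 * atan (sin tau * sin (s / 2) * cos (s / 2) / (A ^ 2 + B ^ 2))) by reflexivity.
fold A in HA. fold al. rewrite Eg, Eb. clear Eg Eb.
clearbody A B al.
unfold expYrot, expY. rewrite !(Rmult_div_r 2) by lra.
set (c := cos (al / 2)) in *. set (S := sin (al / 2)) in *.
set (x := cos (s / 2)) in *. set (y := sin (s / 2)) in *.
set (Ct := cos tau) in *. set (D := sin tau) in *. clearbody c S x y Ct D.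
set (N := A ^ 2 + B ^ 2). assert (HN : 0 < N) by (unfold N; nra).
set (Y := D * y * x / N).
assert (HY : Y * N = D * y * x) by (unfold Y; field; lra).
(* [M0] and [M1] compute the real and imaginary parts of [w * Cconj z]; dividing by [N], the squared
   modulus of [z], gives [w = i Y z] in the form [R1], [R2]. *)
assert (M0 : (- S * x + c * y * Ct) * A + c * y * D * B = 0).
{ rewrite EA, EB.
  replace (_ + _) with (- S * c * x * x + (c * c - S * S) * (x * y * Ct) + S * c * y * y * (D * D + Ct * Ct)) by ring.
  rewrite E3. lra. }
assert (M1 : c * y * D * A - (- S * x + c * y * Ct) * B = D * y * x).
{ rewrite EA, EB. replace (_ - _) with ((S * S + c * c) * (D * y * x)) by ring.
  rewrite E1. ring. }
assert (R1 : - S * x + c * y * Ct = - Y * B).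
{ apply Rmult_eq_reg_r with N; [|lra].
  replace (- Y * B * N) with (- (Y * N) * B) by ring. rewrite HY, <- M1.
  unfold N. transitivity (A * ((- S * x + c * y * Ct) * A) + B * B * (- S * x + c * y * Ct)).
  ring. replace ((- S * x + c * y * Ct) * A) with (- (c * y * D * B)) by lra. ring. }
assert (R2 : c * y * D = Y * A).
{ apply Rmult_eq_reg_r with N; [|lra].
  replace (Y * A * N) with (Y * N * A) by ring. rewrite HY, <- M1.
  unfold N. transitivity (c * y * D * A * A + B * (c * y * D * B)).
  ring. replace (c * y * D * B) with (- ((- S * x + c * y * Ct) * A)) by lra. ring. }
(* The squared moduli of [z] and [w] are [N] and [Y * Y * N], and they add up to 1 on the group. *)
assert (HN1 : N * (1 + Y * Y) = 1).
{ transitivity (N + (Y * A) * (Y * A) + (- Y * B) * (- Y * B)). unfold N; ring.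
  rewrite <- R1, <- R2. unfold N. rewrite EA, EB.
  transitivity ((S * S + c * c) * (x * x) + (S * S + c * c) * (y * y) * (D * D + Ct * Ct)).
  ring. rewrite E1, E3. lra. }
assert (Hr : 0 < sqrt N) by (apply sqrt_lt_R0; auto).
assert (Hrr : sqrt N * sqrt N = N) by (apply sqrt_sqrt; lra).
assert (Cb : cos (atan Y) = sqrt N /\ sin (atan Y) = Y * sqrt N).
{ rewrite cos_atan, sin_atan. unfold Rsqr.
  replace (1 + Y * Y) with (/ N). rewrite sqrt_inv. split; field; lra.
  apply Rmult_eq_reg_l with N; [|lra]. rewrite HN1. field; lra. }
assert (Cg : cos (atan (B / A)) = A / sqrt N /\ sin (atan (B / A)) = B / sqrt N).
{ rewrite cos_atan, sin_atan. unfold Rsqr.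
  replace (1 + B / A * (B / A)) with (N / (A * A)) by (unfold N; field; lra).
  rewrite sqrt_div_alt by nra. rewrite sqrt_square by lra. split; field; lra. }
destruct Cb as [-> ->], Cg as [-> ->].
apply SU2pt_ext; simpl.
- transitivity (c * A + S * Y * B); [|field; lra].
  replace (S * Y * B) with (- S * (- Y * B)) by ring. rewrite <- R1, EA.
  transitivity ((S * S + c * c) * x); [rewrite E1|]; ring.
- transitivity (c * B - S * (Y * A)); [|field; lra].
  rewrite <- R2, EB. ring.
- transitivity (S * A + c * (- Y * B)); [|field; lra].
  rewrite <- R1, EA. transitivity ((S * S + c * c) * (y * Ct)); [rewrite E1|]; ring.
- transitivity (S * B + c * (Y * A)); [|field; lra].
  rewrite <- R2, EB. transitivity ((S * S + c * c) * (y * D)); [rewrite E1|]; ring.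
Qed.

(** Each factor of the decomposition contributes its own increment of [f], and each increment
    involves a derivative of [f] along one of the three given subgroups. *)
Lemma Cderiv_expYrot (f : SU2pt -> C) (g : SU2pt) (tau : R) : smooth f -> on_SU2 g ->
  Cderiv (fun s => f (su2_mul g (expYrot tau s))) 0
    (Cplus (Cmult (RtoC (cos tau)) (Xf D1 f g)) (Cmult (RtoC (sin tau)) (Xf D2 f g))).
Proof.
intros Hf Hg.
assert (ca : continuous (rot_al tau) 0)
  by (apply (ex_derive_continuous (rot_al tau)); eexists; apply is_derive_rot_al).
assert (cb : continuous (rot_be tau) 0)
  by (apply (ex_derive_continuous (rot_be tau)); eexists; apply is_derive_rot_be).
assert (cr : continuous (rot_re tau) 0)
  by (apply (ex_derive_continuous (rot_re tau)); eexists; apply is_derive_rot_re).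
assert (cc : continuous cos 0)
  by (apply (ex_derive_continuous cos); auto_derive; auto).
set (k1 := fun _ : R => su2_one).
set (k2 := fun s => expY D1 (rot_al tau s)).
set (k3 := fun s => su2_mul (expY D1 (rot_al tau s)) (expY D2 (rot_be tau s))).
assert (I1 := Cderiv_increment f D1 g k1 _ _ Hf Hg (fun _ => on_SU2_one) eq_refl
  (Pcont_const _ _) (rot_al_0 tau) (is_derive_rot_al tau)).
assert (I2 : Cderiv (fun s => Cminus (f (su2_mul (su2_mul g (k2 s)) (expY D2 (rot_be tau s)))) (f (su2_mul g (k2 s)))) 0 (Cmult (RtoC (sin tau)) (Xf D2 f g))).
{ apply Cderiv_increment; auto using rot_be_0, is_derive_rot_be.
  - intros; apply on_SU2_expY.
  - unfold k2. rewrite rot_al_0. apply expY_0.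
  - apply Pcont_expY; auto. }
assert (I3 : Cderiv (fun s => Cminus (f (su2_mul (su2_mul g (k3 s)) (expY D0 (rot_ga tau s)))) (f (su2_mul g (k3 s)))) 0 (Cmult (RtoC 0) (Xf D0 f g))).
{ apply Cderiv_increment; auto using rot_ga_0, is_derive_rot_ga.
  - intros; apply on_SU2_mul; apply on_SU2_expY.
  - unfold k3. rewrite rot_al_0, rot_be_0, !expY_0. apply su2_mul1.
  - apply Pcont_mul; apply Pcont_expY; auto. }
(* The telescoping sum: [f g] plus the three increments equals [f (su2_mul g (expYrot tau s))]
   wherever the decomposition holds. *)
assert (I := Cderiv_plus _ _ _ _ _ (Cderiv_const (f g) 0)
   (Cderiv_plus _ _ _ _ _ (Cderiv_plus _ _ _ _ _ I1 I2) I3)).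
match type of I with Cderiv _ _ ?l => replace (Cplus _ _) with l by ring end.
eapply Cderiv_ext_loc; [|exact I].
(* The decomposition needs [cos s] and [rot_re tau s] positive; both equal 1 at [s = 0], so equality
   holds near 0, which is enough for a derivative there. *)
assert (P0 : 0 < cos 0) by (rewrite cos_0; lra).
assert (P1 : 0 < rot_re tau 0) by (rewrite rot_re_0; lra).
generalize (cc _ (locally_ball _ (mkposreal _ P0))) (cr _ (locally_ball _ (mkposreal _ P1))).
unfold filtermap. intros L1 L2. generalize (filter_and _ _ L1 L2). apply filter_imp.
intros s [B1 B2].
change (Rabs (cos s - cos 0) < cos 0) in B1.
change (Rabs (rot_re tau s - rot_re tau 0) < rot_re tau 0) in B2.
apply Rabs_def2 in B1. apply Rabs_def2 in B2.
rewrite (expYrot_decomp tau s) by lra.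
unfold k1, k2, k3. rewrite su2_mul1, !su2_mulA. ring.
Qed.

(** * Complex-valued integrals *)

Lemma Ccont_ex_RInt (F : R -> C) (a b : R) : (forall t, Ccont F t) ->
  ex_RInt (fun t => Re (F t)) a b /\ ex_RInt (fun t => Im (F t)) a b.
Proof.
intros H; split; apply (ex_RInt_continuous (V := R_CompleteNormedModule)); intros; apply H.
Qed.

Lemma CRInt_ext (F G : R -> C) (a b : R) : (forall t, F t = G t) -> CRInt F a b = CRInt G a b.
Proof.
intros H; unfold CRInt; f_equal; apply RInt_ext; intros; rewrite H; reflexivity.
Qed.

Lemma CRInt_plus (F G : R -> C) (a b : R) : (forall t, Ccont F t) -> (forall t, Ccont G t) ->
  CRInt (fun t => Cplus (F t) (G t)) a b = Cplus (CRInt F a b) (CRInt G a b).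
Proof.
intros HF HG. destruct (Ccont_ex_RInt F a b HF), (Ccont_ex_RInt G a b HG).
apply C_ext; simpl.
- apply (RInt_plus (V := R_CompleteNormedModule) (fun t => Re (F t)) (fun t => Re (G t))); auto.
- apply (RInt_plus (V := R_CompleteNormedModule) (fun t => Im (F t)) (fun t => Im (G t))); auto.
Qed.

Lemma RInt_lin (f g : R -> R) (a b x y : R) : ex_RInt f a b -> ex_RInt g a b ->
  RInt (fun t => x * f t + y * g t) a b = x * RInt f a b + y * RInt g a b.
Proof.
intros Hf Hg.
rewrite (RInt_plus (V := R_CompleteNormedModule) (fun t => x * f t) (fun t => y * g t)).
- rewrite (RInt_scal (V := R_CompleteNormedModule) f), (RInt_scal (V := R_CompleteNormedModule) g); auto.
- apply (ex_RInt_scal (V := R_NormedModule) f); auto.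
- apply (ex_RInt_scal (V := R_NormedModule) g); auto.
Qed.

Lemma CRInt_scal (c : C) (F : R -> C) (a b : R) : (forall t, Ccont F t) ->
  CRInt (fun t => Cmult c (F t)) a b = Cmult c (CRInt F a b).
Proof.
intros HF. destruct (Ccont_ex_RInt F a b HF) as [H1 H2].
apply C_ext; simpl.
- transitivity (Re c * RInt (fun t => Re (F t)) a b + - Im c * RInt (fun t => Im (F t)) a b);
  [rewrite <- RInt_lin by auto; apply RInt_ext; intros|]; unfold Re, Im; simpl; ring.
- transitivity (Im c * RInt (fun t => Re (F t)) a b + Re c * RInt (fun t => Im (F t)) a b);
  [rewrite <- RInt_lin by auto; apply RInt_ext; intros|]; unfold Re, Im; simpl; ring.
Qed.

Lemma CRInt_conj (F : R -> C) (a b : R) : (forall t, Ccont F t) ->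
  CRInt (fun t => Cconj (F t)) a b = Cconj (CRInt F a b).
Proof.
intros HF. destruct (Ccont_ex_RInt F a b HF) as [H1 H2].
apply C_ext; simpl. reflexivity.
apply (RInt_opp (V := R_CompleteNormedModule) (fun t => Im (F t))); auto.
Qed.

Lemma CRInt_bound (F : R -> C) (a b M : R) : a <= b -> (forall t, Ccont F t) ->
  (forall t, a <= t <= b -> Cmod (F t) <= M) -> Cmod (CRInt F a b) <= 2 * ((b - a) * M).
Proof.
intros Hab HF HM. destruct (Ccont_ex_RInt F a b HF) as [H1 H2].
assert (B1 : Rabs (RInt (fun t => Re (F t)) a b) <= (b - a) * M).
{ apply abs_RInt_le_const; auto. intros; eapply Rle_trans; [apply re_le_Cmod|auto]. }
assert (B2 : Rabs (RInt (fun t => Im (F t)) a b) <= (b - a) * M).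
{ apply abs_RInt_le_const; auto. intros; eapply Rle_trans; [apply Im_le_Cmod|auto]. }
apply Cmod_le_2; assumption.
Qed.

Lemma CRInt_Cderiv (F dF : R -> C) (a b : R) : (forall t, Cderiv F t (dF t)) ->
  (forall t, Ccont dF t) -> CRInt dF a b = Cminus (F b) (F a).
Proof.
intros H Hc. apply C_ext; apply is_RInt_unique.
- apply (is_RInt_derive (V := R_CompleteNormedModule) (fun t => Re (F t)) (fun t => Re (dF t)));
  intros; [apply H|apply Hc].
- apply (is_RInt_derive (V := R_CompleteNormedModule) (fun t => Im (F t)) (fun t => Im (dF t)));
  intros; [apply H|apply Hc].
Qed.

Lemma is_derive_RInt_cont (h dh : R -> R -> R) (a b s0 : R) :
  (forall s t, is_derive (fun s => h s t) s (dh s t)) ->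
  (forall s t, continuous (fun z : R * R => dh (fst z) (snd z)) (s, t)) ->
  (forall s t, continuous (h s) t) ->
  is_derive (fun s => RInt (h s) a b) s0 (RInt (dh s0) a b).
Proof.
intros H1 H2 H3. evar_last. apply (is_derive_RInt_param h).
- apply filter_forall. intros; eexists; apply H1.
- intros t _. apply (continuity_2d_pt_ext dh).
  intros x y; symmetry; apply is_derive_unique, H1.
  apply continuity_2d_pt_filterlim, H2.
- apply filter_forall. intros; apply (ex_RInt_continuous (V := R_CompleteNormedModule)).
  intros; apply H3.
- apply RInt_ext; intros; apply is_derive_unique, H1.
Qed.

Lemma Cderiv_CRInt (H dH : R -> R -> C) (a b s0 : R) :
  (forall s t, Cderiv (fun s => H s t) s (dH s t)) ->
  (forall s t, Ccont (fun z : R * R => dH (fst z) (snd z)) (s, t)) ->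
  (forall s t, Ccont (H s) t) ->
  Cderiv (fun s => CRInt (H s) a b) s0 (CRInt (dH s0) a b).
Proof.
intros H1 H2 H3. split; simpl.
- apply (is_derive_RInt_cont (fun s t => Re (H s t)) (fun s t => Re (dH s t)));
  intros; [apply H1|apply H2|apply H3].
- apply (is_derive_RInt_cont (fun s t => Im (H s t)) (fun s t => Im (dH s t)));
  intros; [apply H1|apply H2|apply H3].
Qed.

Lemma Ccont_bounded (w : R -> C) (a b : R) : (forall t, Ccont w t) ->
  exists W, 0 < W /\ forall t, a <= t <= b -> Cmod (w t) <= W.
Proof.
intros H.
destruct (bounded_continuity (V := R_NormedModule) (fun t => Re (w t)) a b) as [M1 K1].
{ intros; apply H. }
destruct (bounded_continuity (V := R_NormedModule) (fun t => Im (w t)) a b) as [M2 K2].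
{ intros; apply H. }
exists (2 * Rmax 1 (Rmax M1 M2)).
assert (L := Rmax_l 1 (Rmax M1 M2)). split; [lra|].
intros t Ht. left. apply Cmod_lt_2; (eapply Rlt_le_trans; [|apply Rmax_r]).
- eapply Rlt_le_trans; [apply K1; auto|apply Rmax_l].
- eapply Rlt_le_trans; [apply K2; auto|apply Rmax_r].
Qed.

(** * Averages along the orbits of the neutral one-parameter subgroup *)

(** Used twice: with an exponential weight it is the Green operator, and at the unit it is the
    pairing with the measure [w(t) dt] on the circle [exp(t Y0)]. *)
Definition avg (w : R -> C) (f : SU2pt -> C) (g : SU2pt) : C :=
  CRInt (fun t => Cmult (w t) (f (su2_mul g (expY D0 t)))) 0 (4 * PI).

Lemma Ccont_orbit (f : SU2pt -> C) (g : SU2pt) (j : dir) (t : R) : continuous_SU2 f -> on_SU2 g ->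
  Ccont (fun t => f (su2_mul g (expY j t))) t.
Proof.
intros Hf Hg. apply continuous_SU2_comp; auto using on_SU2_mul_exp.
apply Pcont_mul; [apply Pcont_const|apply Pcont_expY, continuous_id].
Qed.

Lemma Cmod_expY0 (t : R) : Cmod (fst (expY D0 t)) = 1.
Proof.
simpl. rewrite <- sqrt_1. unfold Cmod; simpl. f_equal.
generalize (sin2_cos2_mul (t / 2)). lra.
Qed.

(** Right translation by [expY D0 t] multiplies both entries by the same number of modulus 1. *)
Lemma dist_mul_expY0 (g h : SU2pt) (t : R) :
  Cmod (Cminus (fst (su2_mul h (expY D0 t))) (fst (su2_mul g (expY D0 t)))) =
    Cmod (Cminus (fst h) (fst g)) /\
  Cmod (Cminus (snd (su2_mul h (expY D0 t))) (snd (su2_mul g (expY D0 t)))) =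
    Cmod (Cminus (snd h) (snd g)).
Proof.
split.
- replace (Cminus _ _) with (Cmult (Cminus (fst h) (fst g)) (fst (expY D0 t))).
  rewrite Cmod_mult, Cmod_expY0; ring.
  unfold su2_mul, expY; simpl fst; simpl snd. ring.
- replace (Cminus (snd (su2_mul _ _)) _) with (Cmult (Cminus (snd h) (snd g)) (fst (expY D0 t))).
  rewrite Cmod_mult, Cmod_expY0; ring.
  unfold su2_mul, expY; simpl fst; simpl snd. ring.
Qed.

Lemma continuous_SU2_avg (w : R -> C) (f : SU2pt -> C) : (forall t, Ccont w t) ->
  continuous_SU2 f -> continuous_SU2 (avg w f).
Proof.
intros Hw Hf g Hg eps He.
destruct (Ccont_bounded w 0 (4 * PI) Hw) as [W [HW KW]].
assert (Hpi := PI_RGT_0).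
(* With this [K] the integral bound [2 * (4 * PI) * W * (eps / K)] equals [eps / 2]. *)
set (K := 16 * PI * W). assert (HK : 0 < K) by (unfold K; nra).
destruct (continuous_SU2_unif f Hf (eps / K)) as [d [Hd U]].
{ apply Rdiv_lt_0_compat; auto. }
exists d; split; auto. intros h Hh A B.
assert (Hc : forall g, on_SU2 g -> forall t, Ccont (fun t => Cmult (w t) (f (su2_mul g (expY D0 t)))) t).
{ intros; apply Ccont_mult; auto using Ccont_orbit. }
replace (Cminus (avg w f h) (avg w f g)) with
  (CRInt (fun t => Cmult (w t) (Cminus (f (su2_mul h (expY D0 t))) (f (su2_mul g (expY D0 t))))) 0 (4 * PI)).
- apply Rle_lt_trans with (2 * ((4 * PI - 0) * (W * (eps / K)))).
  + apply CRInt_bound. lra.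
    * intros; apply Ccont_mult; auto. apply Ccont_plus; [|apply Ccont_opp]; auto using Ccont_orbit.
    * intros t Ht. rewrite Cmod_mult. apply Rmult_le_compat; auto using Cmod_ge_0.
      left. destruct (dist_mul_expY0 g h t) as [E1 E2].
      apply U; auto using on_SU2_mul_exp; [rewrite E1|rewrite E2]; auto.
  + replace (2 * ((4 * PI - 0) * (W * (eps / K)))) with (eps / 2). lra.
    unfold K. field. lra.
- transitivity (CRInt (fun t => Cplus (Cmult (w t) (f (su2_mul h (expY D0 t))))
     (Cmult (RtoC (-1)) (Cmult (w t) (f (su2_mul g (expY D0 t)))))) 0 (4 * PI)).
  apply CRInt_ext; intros.
  { apply C_ext; unfold Re, Im; simpl; ring. }
  rewrite CRInt_plus, CRInt_scal; auto.
  + unfold avg. apply C_ext; unfold Re, Im; simpl; ring.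
  + intros; apply Ccont_mult; [apply Ccont_const|auto].
Qed.

(** The derivative of [f] along the direction Ad(exp(-t Y0)) [Yj], which appears when [exp(s Yj)] is
    moved to the right past [exp(t Y0)]. *)
Definition rotX (j : dir) (t : R) (f : SU2pt -> C) (g : SU2pt) : C :=
  match j with
  | D0 => Xf D0 f g
  | D1 => Cplus (Cmult (RtoC (cos t)) (Xf D1 f g)) (Cmult (RtoC (sin t)) (Xf D2 f g))
  | D2 => Cplus (Cmult (RtoC (- sin t)) (Xf D1 f g)) (Cmult (RtoC (cos t)) (Xf D2 f g))
  end.

Lemma cos_PI2_plus (t : R) : cos (t + PI / 2) = - sin t.
Proof. rewrite cos_plus, cos_PI2, sin_PI2; ring. Qed.
Lemma sin_PI2_plus (t : R) : sin (t + PI / 2) = cos t.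
Proof. rewrite sin_plus, cos_PI2, sin_PI2; ring. Qed.

(* Right translation by [expY D0 t] rotates the plane of [Y1, Y2] by the angle [t]. *)
Lemma expY_expY0 (j : dir) (s t : R) : su2_mul (expY j s) (expY D0 t) =
  su2_mul (expY D0 t) (match j with D0 => expY D0 s | D1 => expYrot t s
                       | D2 => expYrot (t + PI / 2) s end).
Proof.
assert (Ec : cos t = cos (t / 2) * cos (t / 2) - sin (t / 2) * sin (t / 2)).
{ replace t with (2 * (t / 2)) at 1 by field. apply cos_2a. }
assert (Es : sin t = 2 * sin (t / 2) * cos (t / 2)).
{ replace t with (2 * (t / 2)) at 1 by field. apply sin_2a. }
assert (E := sin2_cos2_mul (t / 2)).
destruct j; unfold expYrot; rewrite ?cos_PI2_plus, ?sin_PI2_plus, ?Ec, ?Es;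
  apply SU2pt_ext; simpl; try ring.
- transitivity (sin (s / 2) * cos (t / 2) * (sin (t / 2) * sin (t / 2) + cos (t / 2) * cos (t / 2)));
  [rewrite E|]; ring.
- transitivity (sin (s / 2) * sin (t / 2) * (sin (t / 2) * sin (t / 2) + cos (t / 2) * cos (t / 2)));
  [rewrite E|]; ring.
- transitivity (- sin (s / 2) * sin (t / 2) * (sin (t / 2) * sin (t / 2) + cos (t / 2) * cos (t / 2)));
  [rewrite E|]; ring.
- transitivity (sin (s / 2) * cos (t / 2) * (sin (t / 2) * sin (t / 2) + cos (t / 2) * cos (t / 2)));
  [rewrite E|]; ring.
Qed.

Lemma Cderiv_translate (f : SU2pt -> C) (j : dir) (g : SU2pt) (s t : R) : smooth f -> on_SU2 g ->
  Cderiv (fun s => f (su2_mul (su2_mul g (expY j s)) (expY D0 t))) s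
    (rotX j t f (su2_mul (su2_mul g (expY j s)) (expY D0 t))).
Proof.
intros Hf Hg. apply Cderiv_shift.
set (h := su2_mul g (expY j s)). assert (Hh : on_SU2 h) by (apply on_SU2_mul_exp; auto).
set (k := su2_mul h (expY D0 t)). assert (Hk : on_SU2 k) by (apply on_SU2_mul_exp; auto).
apply (Cderiv_ext (fun r => f (su2_mul k (match j with D0 => expY D0 r | D1 => expYrot t r
                       | D2 => expYrot (t + PI / 2) r end)))).
{ intros r. f_equal. unfold k, h. rewrite expY_plus, !su2_mulA. do 2 f_equal.
  symmetry; apply expY_expY0. }
destruct j; simpl rotX.
- apply (smooth_is_Xf f D0 k); auto.
- apply Cderiv_expYrot; auto.
- rewrite <- (sin_PI2_plus t), <- (cos_PI2_plus t). apply Cderiv_expYrot; auto.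
Qed.

Lemma Ccont_RtoC {T : UniformSpace} (u : T -> R) (x : T) : continuous u x ->
  Ccont (fun y => RtoC (u y)) x.
Proof. intros; apply Ccont_pair; auto using continuous_const. Qed.

Lemma continuous_cosR (t : R) : continuous cos t.
Proof. apply (ex_derive_continuous cos); auto_derive; auto. Qed.
Lemma continuous_sinR (t : R) : continuous sin t.
Proof. apply (ex_derive_continuous sin); auto_derive; auto. Qed.

Lemma is_Xf_avg (w : R -> C) (f : SU2pt -> C) (j : dir) (g : SU2pt) :
  (forall t, Ccont w t) -> smooth f -> on_SU2 g ->
  is_Xf j (avg w f) g
    (CRInt (fun t => Cmult (w t) (rotX j t f (su2_mul g (expY D0 t)))) 0 (4 * PI)).
Proof.
intros Hw Hf Hg. unfold is_Xf, avg.
set (H := fun s t => Cmult (w t) (f (su2_mul (su2_mul g (expY j s)) (expY D0 t)))).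
set (dH := fun s t => Cmult (w t) (rotX j t f (su2_mul (su2_mul g (expY j s)) (expY D0 t)))).
replace (CRInt _ _ _) with (CRInt (dH 0) 0 (4 * PI))
  by (apply CRInt_ext; intros; unfold dH; rewrite expY_0, su2_mul1; reflexivity).
apply (Cderiv_CRInt H dH).
- intros s t. unfold H, dH.
  replace (Cmult (w t) _) with
    (Cplus (Cmult (RtoC 0) (f (su2_mul (su2_mul g (expY j s)) (expY D0 t))))
     (Cmult (w t) (rotX j t f (su2_mul (su2_mul g (expY j s)) (expY D0 t))))) by ring.
  apply (Cderiv_mult (fun _ => w t) (fun s => f (su2_mul (su2_mul g (expY j s)) (expY D0 t)))).
  apply Cderiv_const. apply Cderiv_translate; auto.
- intros s t. unfold dH. apply Ccont_mult.
  apply (Ccont_comp snd w); [apply continuous_snd|apply Hw].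
  assert (HX : forall i, Ccont (fun z : R * R =>
     Xf i f (su2_mul (su2_mul g (expY j (fst z))) (expY D0 (snd z)))) (s, t)).
  { intros i. apply continuous_SU2_comp.
    - apply smooth_continuous, smooth_Xf; auto.
    - intros; repeat apply on_SU2_mul_exp; auto.
    - apply Pcont_mul; [apply Pcont_mul; [apply Pcont_const|]|];
      apply Pcont_expY; [apply continuous_fst|apply continuous_snd]. }
  assert (HC : Ccont (fun z : R * R => RtoC (cos (snd z))) (s, t)).
  { apply Ccont_RtoC, (continuous_comp snd cos); [apply continuous_snd|apply continuous_cosR]. }
  assert (HS : Ccont (fun z : R * R => RtoC (sin (snd z))) (s, t)).
  { apply Ccont_RtoC, (continuous_comp snd sin); [apply continuous_snd|apply continuous_sinR]. }
  assert (HS' : Ccont (fun z : R * R => RtoC (- sin (snd z))) (s, t)).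
  { apply Ccont_RtoC, (continuous_comp snd (fun t => - sin t)); [apply continuous_snd|].
    apply (continuous_opp sin), continuous_sinR. }
  destruct j; simpl rotX; auto; apply Ccont_plus; apply Ccont_mult; auto.
- intros s t. apply Ccont_mult; auto. apply Ccont_orbit; auto using smooth_continuous, on_SU2_mul_exp.
Qed.

(** Differentiating an average along [Y1] or [Y2] yields two averages, of [Xf D1 f] and [Xf D2 f],
    with weights multiplied by trigonometric functions. Closing under sums gives a class to which
    [smooth_coind] applies. *)
Inductive avg_sum : (SU2pt -> C) -> Prop :=
| avg_sum_avg w f : (forall t, Ccont w t) -> smooth f -> avg_sum (avg w f)
| avg_sum_plus f1 f2 : avg_sum f1 -> avg_sum f2 -> avg_sum (fun g => Cplus (f1 g) (f2 g)).

Lemma avg_comb (w : R -> C) (f1 f2 : SU2pt -> C) (c1 c2 : R -> R) (g : SU2pt) :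
  (forall t, Ccont w t) -> (forall t, continuous c1 t) -> (forall t, continuous c2 t) ->
  continuous_SU2 f1 -> continuous_SU2 f2 -> on_SU2 g ->
  CRInt (fun t => Cmult (w t) (Cplus (Cmult (RtoC (c1 t)) (f1 (su2_mul g (expY D0 t))))
                                     (Cmult (RtoC (c2 t)) (f2 (su2_mul g (expY D0 t)))))) 0 (4 * PI)
  = Cplus (avg (fun t => Cmult (w t) (RtoC (c1 t))) f1 g)
          (avg (fun t => Cmult (w t) (RtoC (c2 t))) f2 g).
Proof.
intros Hw H1 H2 F1 F2 Hg. unfold avg. rewrite <- CRInt_plus.
- apply CRInt_ext; intros; ring.
- intros; apply Ccont_mult; [apply Ccont_mult; [apply Hw|apply Ccont_RtoC; auto]|apply Ccont_orbit; auto].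
- intros; apply Ccont_mult; [apply Ccont_mult; [apply Hw|apply Ccont_RtoC; auto]|apply Ccont_orbit; auto].
Qed.

Lemma smooth_avg_sum (f : SU2pt -> C) : avg_sum f -> smooth f.
Proof.
apply smooth_coind. clear f. intros f Hf. induction Hf as [w f Hw Hf|f1 f2 _ [c1 H1] _ [c2 H2]].
- split. apply continuous_SU2_avg; auto using smooth_continuous.
  assert (Hcs : forall i, continuous_SU2 (Xf i f)) by auto using smooth_continuous, smooth_Xf.
  assert (Hs' : forall t, continuous (fun t => - sin t) t).
  { intros t; apply (continuous_opp sin), continuous_sinR. }
  assert (Hw2 : forall c, (forall t, continuous c t) -> forall t, Ccont (fun t => Cmult (w t) (RtoC (c t))) t).
  { intros; apply Ccont_mult; auto using Ccont_RtoC. }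
  assert (Hcos := continuous_cosR). assert (Hsin := continuous_sinR).
  intros j. destruct j.
  + exists (avg w (Xf D0 f)); split. constructor; auto using smooth_Xf.
    intros g Hg. apply (is_Xf_avg w f D0); auto.
  + exists (fun g => Cplus (avg (fun t => Cmult (w t) (RtoC (cos t))) (Xf D1 f) g)
       (avg (fun t => Cmult (w t) (RtoC (sin t))) (Xf D2 f) g)).
    split. apply avg_sum_plus; apply avg_sum_avg; auto using smooth_Xf.
    intros g Hg. rewrite <- avg_comb by auto. apply (is_Xf_avg w f D1); auto.
  + exists (fun g => Cplus (avg (fun t => Cmult (w t) (RtoC (- sin t))) (Xf D1 f) g)
       (avg (fun t => Cmult (w t) (RtoC (cos t))) (Xf D2 f) g)).
    split. apply avg_sum_plus; apply avg_sum_avg; auto using smooth_Xf.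
    intros g Hg. rewrite <- (avg_comb w _ _ (fun t => - sin t)) by auto.
    apply (is_Xf_avg w f D2); auto.
- split. apply continuous_SU2_plus; auto.
  intros j. destruct (H1 j) as [f1' [S1 X1]], (H2 j) as [f2' [S2 X2]].
  exists (fun g => Cplus (f1' g) (f2' g)). split. apply avg_sum_plus; auto.
  intros; apply is_Xf_plus; auto.
Qed.

Lemma smooth_avg (w : R -> C) (f : SU2pt -> C) : (forall t, Ccont w t) -> smooth f ->
  smooth (avg w f).
Proof. intros; apply smooth_avg_sum; constructor; auto. Qed.

Lemma Xf0_avg (w : R -> C) (f : SU2pt -> C) (g : SU2pt) :
  (forall t, Ccont w t) -> smooth f -> on_SU2 g -> Xf D0 (avg w f) g = avg w (Xf D0 f) g.
Proof. intros; apply is_Xf_unique. apply (is_Xf_avg w f D0); auto. Qed.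

(** Integration by parts along the orbit. The orbit closes up after [4 PI], so both boundary terms
    are multiples of [f g]. *)
Lemma avg_Xf0 (w dw : R -> C) (f : SU2pt -> C) (g : SU2pt) :
  (forall t, Cderiv w t (dw t)) -> (forall t, Ccont dw t) -> smooth f -> on_SU2 g ->
  avg w (Xf D0 f) g =
  Cminus (Cmult (Cminus (w (4 * PI)) (w 0)) (f g)) (avg dw f g).
Proof.
intros Hw Hdw Hf Hg.
assert (Hwc : forall t, Ccont w t) by (intros; eapply Cderiv_Ccont; apply Hw).
assert (C1 : forall t, Ccont (fun t => Cmult (dw t) (f (su2_mul g (expY D0 t)))) t).
{ intros; apply Ccont_mult; auto using Ccont_orbit, smooth_continuous. }
assert (C2 : forall t, Ccont (fun t => Cmult (w t) (Xf D0 f (su2_mul g (expY D0 t)))) t).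
{ intros; apply Ccont_mult; auto using Ccont_orbit, smooth_continuous, smooth_Xf. }
assert (E : Cplus (avg dw f g) (avg w (Xf D0 f) g) =
   Cminus (Cmult (w (4 * PI)) (f (su2_mul g (expY D0 (4 * PI)))))
          (Cmult (w 0) (f (su2_mul g (expY D0 0))))).
{ unfold avg. rewrite <- CRInt_plus by auto.
  apply (CRInt_Cderiv (fun t => Cmult (w t) (f (su2_mul g (expY D0 t))))).
  - intros t. apply Cderiv_mult; auto. apply Cderiv_orbit; auto.
  - intros t. apply Ccont_plus; auto. }
rewrite expY_0, expY0_4PI, su2_mul1 in E.
replace (avg w (Xf D0 f) g) with (Cminus (Cplus (avg dw f g) (avg w (Xf D0 f) g)) (avg dw f g)) by ring.
rewrite E. ring.
Qed.

(** * The Haar integral *)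

(** Uniform continuity for an abstract closeness relation [near d], so that the same lemmas serve
    for each partial integral of the iterated Haar integral and for functions on the group. *)
Definition unif {X : Type} (near : R -> X -> X -> Prop) (h : X -> R) : Prop :=
  forall eps, 0 < eps -> exists d, 0 < d /\ forall x x', near d x x' -> Rabs (h x' - h x) < eps.

Definition near_prod {X : Type} (near : R -> X -> X -> Prop) (d : R) (p q : X * R) : Prop :=
  near d (fst p) (fst q) /\ Rabs (snd q - snd p) < d.

Definition near_refl {X : Type} (near : R -> X -> X -> Prop) : Prop :=
  forall d x, 0 < d -> near d x x.

Section Unif.
Context {X : Type} (near : R -> X -> X -> Prop) (Hr : near_refl near).

Lemma near_prod_refl : near_refl (near_prod near).
Proof.
intros d [x y] Hd; split; simpl; auto. rewrite Rminus_diag, Rabs_R0; auto.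
Qed.

Lemma unif_continuous (h : X * R -> R) (x : X) (z : R) : unif (near_prod near) h ->
  continuous (fun z => h (x, z)) z.
Proof.
intros H P [eps He]. destruct (H eps (cond_pos eps)) as [d [Hd K]].
exists (mkposreal d Hd). intros y Hy. apply He. apply (K (x, z) (x, y)).
split; simpl; auto.
Qed.

Lemma unif_ex_RInt (h : X * R -> R) (x : X) (a b : R) : unif (near_prod near) h ->
  ex_RInt (fun z => h (x, z)) a b.
Proof.
intros H; apply (ex_RInt_continuous (V := R_CompleteNormedModule)).
intros; apply unif_continuous; auto.
Qed.

Lemma unif_RInt (h : X * R -> R) (a b : R) : a <= b -> unif (near_prod near) h ->
  unif near (fun x => RInt (fun z => h (x, z)) a b).
Proof.
intros Hab H eps He.
(* The added 1 covers [a = b] and keeps the final inequality strict. *)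
destruct (H (eps / (b - a + 1))) as [d [Hd K]].
{ apply Rdiv_lt_0_compat; lra. }
exists d; split; auto. intros x x' Hx.
replace (RInt (fun z => h (x', z)) a b - RInt (fun z => h (x, z)) a b) with
  (RInt (fun z => minus (h (x', z)) (h (x, z))) a b)
  by (apply (RInt_minus (V := R_CompleteNormedModule)); apply unif_ex_RInt; auto).
apply Rle_lt_trans with ((b - a) * (eps / (b - a + 1))).
- apply abs_RInt_le_const; auto.
  + apply (ex_RInt_minus (V := R_NormedModule) (fun z => h (x', z)) (fun z => h (x, z)));
    apply unif_ex_RInt; auto.
  + intros t _. left. apply (K (x, t) (x', t)). split; simpl; auto.
    rewrite Rminus_diag, Rabs_R0; auto.
- apply Rmult_lt_reg_r with (b - a + 1); [lra|].
  replace ((b - a) * (eps / (b - a + 1)) * (b - a + 1)) with ((b - a) * eps) by (field; lra).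
  nra.
Qed.

Lemma unif_lin (h k : X -> R) (x y : R) : unif near h -> unif near k ->
  (forall d e p q, d <= e -> near d p q -> near e p q) ->
  unif near (fun p => x * h p + y * k p).
Proof.
intros H K Hmon eps He.
assert (Px := Rabs_pos x). assert (Py := Rabs_pos y).
set (e := eps / (Rabs x + Rabs y + 1)).
assert (Hee : 0 < e) by (apply Rdiv_lt_0_compat; lra).
destruct (H e Hee) as [d1 [D1 K1]]. destruct (K e Hee) as [d2 [D2 K2]].
exists (Rmin d1 d2); split; [apply Rmin_glb_lt; auto|].
intros p q Hpq.
assert (L1 := K1 p q (Hmon _ _ _ _ (Rmin_l _ _) Hpq)).
assert (L2 := K2 p q (Hmon _ _ _ _ (Rmin_r _ _) Hpq)).
replace (x * h q + y * k q - (x * h p + y * k p)) with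
  (x * (h q - h p) + y * (k q - k p)) by ring.
eapply Rle_lt_trans; [apply Rabs_triang|]. rewrite !Rabs_mult.
assert (E : e * (Rabs x + Rabs y + 1) = eps) by (unfold e; field; lra).
assert (Rabs x * Rabs (h q - h p) <= Rabs x * e) by (apply Rmult_le_compat_l; lra).
assert (Rabs y * Rabs (k q - k p) <= Rabs y * e) by (apply Rmult_le_compat_l; lra).
lra.
Qed.

Lemma unif_mult (h k : X -> R) (M : R) : unif near h -> unif near k ->
  (forall p, Rabs (h p) <= M) -> (forall p, Rabs (k p) <= M) ->
  (forall d e p q, d <= e -> near d p q -> near e p q) ->
  unif near (fun p => h p * k p).
Proof.
intros H K Bh Bk Hmon eps He.
destruct (Rle_lt_dec M 0) as [HM|HM].
{ exists 1; split; [lra|]. intros p q _.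
  assert (Z : forall r, h r = 0).
  { intros r. specialize (Bh r). assert (P := Rabs_pos (h r)).
    destruct (Req_dec (h r) 0) as [E|E]; auto. apply Rabs_pos_lt in E. lra. }
  rewrite !Z. rewrite !Rmult_0_l, Rminus_diag, Rabs_R0; auto. }
assert (Hee : 0 < eps / (2 * M)) by (apply Rdiv_lt_0_compat; lra).
destruct (H _ Hee) as [d1 [D1 K1]]. destruct (K _ Hee) as [d2 [D2 K2]].
exists (Rmin d1 d2); split; [apply Rmin_glb_lt; auto|].
intros p q Hpq.
assert (L1 := K1 p q (Hmon _ _ _ _ (Rmin_l _ _) Hpq)).
assert (L2 := K2 p q (Hmon _ _ _ _ (Rmin_r _ _) Hpq)).
replace (h q * k q - h p * k p) with ((h q - h p) * k q + h p * (k q - k p)) by ring.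
eapply Rle_lt_trans; [apply Rabs_triang|]. rewrite !Rabs_mult.
assert (E : eps / (2 * M) * M = eps / 2) by (field; lra).
apply Rle_lt_trans with (Rabs (h q - h p) * M + M * Rabs (k q - k p)).
- apply Rplus_le_compat; [apply Rmult_le_compat_l|apply Rmult_le_compat_r]; auto using Rabs_pos.
- assert (Rabs (h q - h p) * M < eps / (2 * M) * M) by (apply Rmult_lt_compat_r; auto).
  assert (M * Rabs (k q - k p) < M * (eps / (2 * M))) by (apply Rmult_lt_compat_l; auto).
  lra.
Qed.

Lemma near_prod_mono : (forall d e p q, d <= e -> near d p q -> near e p q) ->
  forall d e p q, d <= e -> near_prod near d p q -> near_prod near e p q.
Proof. intros H d e p q Hde [H1 H2]; split; [eapply H; eauto|lra]. Qed.

End Unif.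

(* Starting the iterated product from [unit] lets [unif_RInt] integrate out the
   three Hopf coordinates one after the other. *)
Definition near0 (d : R) (x y : unit) : Prop := True.
Definition near1 := near_prod near0.
Definition near2 := near_prod near1.
Definition near3 := near_prod near2.

Lemma near0_refl : near_refl near0. Proof. intros d x Hd; exact I. Qed.
Lemma near1_refl : near_refl near1. Proof. apply near_prod_refl, near0_refl. Qed.
Lemma near2_refl : near_refl near2. Proof. apply near_prod_refl, near1_refl. Qed.

Lemma near3_mono : forall d e p q, d <= e -> near3 d p q -> near3 e p q.
Proof. do 3 apply near_prod_mono. unfold near0; auto. Qed.

Definition int3 (h : unit * R * R * R -> R) : R :=
  RInt (fun eta => RInt (fun al => RInt (fun be =>
    h (tt, eta, al, be)) 0 (2 * PI)) 0 (2 * PI)) 0 (PI / 2).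

Lemma two_PI_ge0 : 0 <= 2 * PI. Proof. generalize PI_RGT_0; lra. Qed.

Lemma unif_int1 (h : unit * R * R * R -> R) : unif near3 h ->
  unif near2 (fun p => RInt (fun be => h (p, be)) 0 (2 * PI)).
Proof. apply unif_RInt; auto using near2_refl, two_PI_ge0. Qed.

Lemma unif_int2 (h : unit * R * R * R -> R) : unif near3 h ->
  unif near1 (fun p => RInt (fun al => RInt (fun be => h (p, al, be)) 0 (2 * PI)) 0 (2 * PI)).
Proof.
intros H. apply (unif_RInt near1 near1_refl
  (fun p => RInt (fun be => h (p, be)) 0 (2 * PI))); auto using two_PI_ge0, unif_int1.
Qed.

Lemma int3_lin (h k : unit * R * R * R -> R) (x y : R) : unif near3 h -> unif near3 k ->
  int3 (fun p => x * h p + y * k p) = x * int3 h + y * int3 k.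
Proof.
intros Hh Hk. unfold int3.
rewrite <- RInt_lin.
2: { apply (unif_ex_RInt near0 near0_refl (fun p => RInt (fun al => RInt (fun be => h (p, al, be)) 0 (2 * PI)) 0 (2 * PI))). apply unif_int2; auto. }
2: { apply (unif_ex_RInt near0 near0_refl (fun p => RInt (fun al => RInt (fun be => k (p, al, be)) 0 (2 * PI)) 0 (2 * PI))). apply unif_int2; auto. }
apply RInt_ext. intros eta _. rewrite <- RInt_lin.
2: { apply (unif_ex_RInt near1 near1_refl (fun p => RInt (fun be => h (p, be)) 0 (2 * PI))). apply unif_int1; auto. }
2: { apply (unif_ex_RInt near1 near1_refl (fun p => RInt (fun be => k (p, be)) 0 (2 * PI))). apply unif_int1; auto. }
apply RInt_ext. intros al _. rewrite <- RInt_lin; auto.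
- apply (unif_ex_RInt near2 near2_refl h); auto.
- apply (unif_ex_RInt near2 near2_refl k); auto.
Qed.

(** A bound depending on [eta] alone keeps track of decay away from [eta = 0]; the two angles
    contribute [(2 * PI) ^ 2]. *)
Lemma int3_bound (h : unit * R * R * R -> R) (B : R -> R) (l : R) : unif near3 h ->
  (forall eta al be, 0 <= eta <= PI / 2 -> Rabs (h (tt, eta, al, be)) <= B eta) ->
  is_RInt B 0 (PI / 2) l -> Rabs (int3 h) <= 4 * PI ^ 2 * l.
Proof.
intros Hh HB Hl. assert (Hpi := PI_RGT_0).
assert (HlB : is_RInt (fun eta => 4 * PI ^ 2 * B eta) 0 (PI / 2) (4 * PI ^ 2 * l)).
{ apply (is_RInt_scal (V := R_NormedModule) B); auto. }
assert (Hex : ex_RInt (fun eta => RInt (fun al => RInt (fun be => h (tt, eta, al, be)) 0 (2 * PI)) 0 (2 * PI)) 0 (PI / 2)).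
{ apply (unif_ex_RInt near0 near0_refl (fun p => RInt (fun al => RInt (fun be => h (p, al, be)) 0 (2 * PI)) 0 (2 * PI))). apply unif_int2; auto. }
apply (norm_RInt_le (V := R_NormedModule) (fun eta => RInt (fun al => RInt (fun be => h (tt, eta, al, be)) 0 (2 * PI)) 0 (2 * PI)) (fun eta => 4 * PI ^ 2 * B eta) 0 (PI / 2)); auto.
- lra.
- intros eta Heta.
  replace (4 * PI ^ 2 * B eta) with ((2 * PI - 0) * ((2 * PI - 0) * B eta)) by ring.
  apply (abs_RInt_le_const (fun al => RInt (fun be => h (tt, eta, al, be)) 0 (2 * PI))); [lra| |].
  + apply (unif_ex_RInt near1 near1_refl (fun p => RInt (fun be => h (p, be)) 0 (2 * PI))). apply unif_int1; auto.
  + intros al _. apply abs_RInt_le_const; [lra| |auto].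
    apply (unif_ex_RInt near2 near2_refl h); auto.
- apply (RInt_correct (V := R_CompleteNormedModule)); auto.
Qed.

Lemma RInt_periodic_shift (f : R -> R) (c L : R) : (forall x, continuous f x) ->
  (forall x, f (x + L) = f x) -> RInt (fun x => f (x + c)) 0 L = RInt f 0 L.
Proof.
intros Hc HL.
assert (Hex : forall a b, ex_RInt f a b).
{ intros; apply (ex_RInt_continuous (V := R_CompleteNormedModule)); auto. }
assert (Hsh : forall a b d, RInt (fun x => f (x + d)) a b = RInt f (a + d) (b + d)).
{ intros a b d. generalize (RInt_comp_lin (V := R_CompleteNormedModule) f 1 d a b (Hex _ _)).
  rewrite !Rmult_1_l. intros <-. apply RInt_ext; intros x _.
  unfold scal; simpl; unfold mult; simpl. rewrite !Rmult_1_l; reflexivity. }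
assert (Ch := fun a b c => RInt_Chasles (V := R_CompleteNormedModule) f a b c (Hex _ _) (Hex _ _)).
assert (P : RInt f L (c + L) = RInt f 0 c).
{ replace L with (0 + L) at 1 by ring. rewrite <- Hsh. apply RInt_ext; auto. }
rewrite Hsh, Rplus_0_l.
rewrite <- (Ch c 0 (L + c)), <- (Ch 0 L (L + c)).
rewrite (Rplus_comm L c), P.
rewrite <- (opp_RInt_swap (V := R_CompleteNormedModule) f c 0) by apply Hex.
unfold plus, opp; simpl. ring.
Qed.

Lemma int3_shift (h : unit * R * R * R -> R) (c : R) : unif near3 h ->
  (forall p al be, h (p, al + 2 * PI, be) = h (p, al, be)) ->
  (forall p al be, h (p, al, be + 2 * PI) = h (p, al, be)) ->
  int3 (fun q => match q with (p, al, be) => h (p, al + c, be + c) end) = int3 h.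
Proof.
intros Hh P1 P2. apply RInt_ext; intros eta _.
transitivity (RInt (fun al => RInt (fun be => h (tt, eta, al + c, be)) 0 (2 * PI)) 0 (2 * PI)).
- apply RInt_ext; intros al _.
  apply (RInt_periodic_shift (fun be => h (tt, eta, al + c, be))); auto.
  intros; apply (unif_continuous near2 near2_refl h); auto.
- apply (RInt_periodic_shift (fun al => RInt (fun be => h (tt, eta, al, be)) 0 (2 * PI))).
  + intros. apply (unif_continuous near1 near1_refl (fun p => RInt (fun be => h (p, be)) 0 (2 * PI))).
    apply unif_int1; auto.
  + intros; apply RInt_ext; auto.
Qed.

(** What makes every stage of the iterated integral legitimate: uniform continuity makes each inner
    integral continuous in the remaining coordinates, and boundedness allows multiplication by the
    density. *)
Definition bounded_unif (F : SU2pt -> R) : Prop :=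
  (forall eps, 0 < eps -> exists d, 0 < d /\ forall g h, on_SU2 g -> on_SU2 h ->
    Cmod (Cminus (fst h) (fst g)) < d -> Cmod (Cminus (snd h) (snd g)) < d ->
    Rabs (F h - F g) < eps) /\
  exists M, 0 < M /\ forall g, on_SU2 g -> Rabs (F g) <= M.

Lemma bounded_unif_Re (f : SU2pt -> C) : continuous_SU2 f -> bounded_unif (fun g => Re (f g)).
Proof.
intros Hf; split.
- intros eps He. destruct (continuous_SU2_unif f Hf eps He) as [d [Hd K]].
  exists d; split; auto. intros. eapply Rle_lt_trans; [|apply (K g h); auto].
  apply (re_le_Cmod (Cminus (f h) (f g))).
- destruct (continuous_SU2_bounded f Hf) as [M [HM K]]. exists M; split; auto.
  intros; eapply Rle_trans; [apply re_le_Cmod|auto].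
Qed.

Lemma bounded_unif_Im (f : SU2pt -> C) : continuous_SU2 f -> bounded_unif (fun g => Im (f g)).
Proof.
intros Hf; split.
- intros eps He. destruct (continuous_SU2_unif f Hf eps He) as [d [Hd K]].
  exists d; split; auto. intros. eapply Rle_lt_trans; [|apply (K g h); auto].
  apply (Im_le_Cmod (Cminus (f h) (f g))).
- destruct (continuous_SU2_bounded f Hf) as [M [HM K]]. exists M; split; auto.
  intros; eapply Rle_trans; [apply Im_le_Cmod|auto].
Qed.

Lemma on_SU2_hopf (eta al be : R) : on_SU2 (hopf eta al be).
Proof.
apply on_SU2_coord; simpl.
transitivity (cos eta * cos eta * (sin al * sin al + cos al * cos al) +
  sin eta * sin eta * (sin be * sin be + cos be * cos be)). ring.
rewrite !sin2_cos2_mul. generalize (sin2_cos2_mul eta); lra.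
Qed.

Lemma lipschitz_of_deriv (f df : R -> R) (x y : R) : (forall t, is_derive f t (df t)) ->
  (forall t, Rabs (df t) <= 1) -> Rabs (f y - f x) <= Rabs (y - x).
Proof.
intros H B. destruct (MVT_gen f x y df) as [c [_ E]].
- intros; apply H.
- intros. apply derivable_continuous_pt. exists (df x0). apply is_derive_Reals, H.
- rewrite E, Rabs_mult. rewrite <- (Rmult_1_l (Rabs (y - x))) at 2.
  apply Rmult_le_compat_r; auto using Rabs_pos.
Qed.

Lemma Rabs_cos_le1 (x : R) : Rabs (cos x) <= 1.
Proof. apply Rabs_le, COS_bound. Qed.
Lemma Rabs_sin_le1 (x : R) : Rabs (sin x) <= 1.
Proof. apply Rabs_le, SIN_bound. Qed.

Lemma cos_lipschitz (x y : R) : Rabs (cos y - cos x) <= Rabs (y - x).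
Proof.
apply (lipschitz_of_deriv cos (fun t => - sin t)).
- intros t; auto_derive; auto; ring.
- intros; rewrite Rabs_Ropp; apply Rabs_sin_le1.
Qed.

Lemma sin_lipschitz (x y : R) : Rabs (sin y - sin x) <= Rabs (y - x).
Proof.
apply (lipschitz_of_deriv sin cos).
- intros t; auto_derive; auto; ring.
- apply Rabs_cos_le1.
Qed.

Lemma Rabs_prod_diff (a b a' b' d : R) : Rabs a <= 1 -> Rabs b' <= 1 ->
  Rabs (a' - a) < d -> Rabs (b' - b) < d -> Rabs (a' * b' - a * b) < 2 * d.
Proof.
intros. replace (a' * b' - a * b) with ((a' - a) * b' + a * (b' - b)) by ring.
eapply Rle_lt_trans; [apply Rabs_triang|]. rewrite !Rabs_mult.
assert (P1 := Rabs_pos (a' - a)). assert (P2 := Rabs_pos (b' - b)).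
assert (P3 := Rabs_pos a). assert (P4 := Rabs_pos b'). nra.
Qed.

Definition haar_density (F : SU2pt -> R) (p : unit * R * R * R) : R :=
  match p with (_, eta, al, be) => sin eta * cos eta * F (hopf eta al be) end.

(** The entries of [hopf] are products of sines and cosines, hence Lipschitz on the whole parameter
    space, so uniform continuity on the group lifts to it. *)
Lemma unif_haar_density (F : SU2pt -> R) : bounded_unif F -> unif near3 (haar_density F).
Proof.
intros [HF [M [HM BM]]].
assert (U1 : unif near3 (fun p : unit * R * R * R => match p with (_, eta, _, _) => sin eta * cos eta end)).
{ intros eps He. exists (eps / 2); split; [lra|].
  intros [[[u eta] al] be] [[[u' eta'] al'] be'] [[[_ H1] H2] H3]. simpl in *.
  replace eps with (2 * (eps / 2)) by field.
  apply Rabs_prod_diff; auto using Rabs_sin_le1, Rabs_cos_le1;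
  (eapply Rle_lt_trans; [|exact H1]); auto using sin_lipschitz, cos_lipschitz. }
assert (U2 : unif near3 (fun p : unit * R * R * R => match p with (_, eta, al, be) => F (hopf eta al be) end)).
(* In [d / 4], one factor 2 is lost to the products of two trigonometric functions and one to
   [Cmod_lt_2]. *)
{ intros eps He. destruct (HF eps He) as [d [Hd K]]. exists (d / 4); split; [lra|].
  intros [[[u eta] al] be] [[[u' eta'] al'] be'] [[[_ H1] H2] H3]. simpl in *.
  apply K; auto using on_SU2_hopf.
  - replace d with (2 * (2 * (d / 4))) by field. apply Cmod_lt_2; simpl;
    apply Rabs_prod_diff; auto using Rabs_sin_le1, Rabs_cos_le1;
    solve [eapply Rle_lt_trans; [apply sin_lipschitz|assumption]
          |eapply Rle_lt_trans; [apply cos_lipschitz|assumption]].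
  - replace d with (2 * (2 * (d / 4))) by field. apply Cmod_lt_2; simpl;
    apply Rabs_prod_diff; auto using Rabs_sin_le1, Rabs_cos_le1;
    solve [eapply Rle_lt_trans; [apply sin_lipschitz|assumption]
          |eapply Rle_lt_trans; [apply cos_lipschitz|assumption]]. }
assert (B1 : forall p : unit * R * R * R,
  Rabs (match p with (_, eta, _, _) => sin eta * cos eta end) <= Rmax 1 M).
{ intros [[[u eta] al] be]. eapply Rle_trans; [|apply Rmax_l]. rewrite Rabs_mult.
  assert (P1 := Rabs_pos (sin eta)). assert (P2 := Rabs_pos (cos eta)).
  assert (Q1 := Rabs_sin_le1 eta). assert (Q2 := Rabs_cos_le1 eta). nra. }
assert (B2 : forall p : unit * R * R * R,
  Rabs (match p with (_, eta, al, be) => F (hopf eta al be) end) <= Rmax 1 M).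
{ intros [[[u eta] al] be]. eapply Rle_trans; [|apply Rmax_r]. auto using on_SU2_hopf. }
intros eps He.
destruct (unif_mult near3 _ _ (Rmax 1 M) U1 U2 B1 B2 near3_mono eps He) as [d [Hd K]].
exists d; split; auto.
intros [[[u eta] al] be] [[[u' eta'] al'] be']. apply K.
Qed.

Lemma haar_int_R_int3 (F : SU2pt -> R) : haar_int_R F = / (2 * PI ^ 2) * int3 (haar_density F).
Proof. reflexivity. Qed.

Lemma haar_int_R_ext (F G : SU2pt -> R) : (forall g, on_SU2 g -> F g = G g) ->
  haar_int_R F = haar_int_R G.
Proof.
intros H. unfold haar_int_R. apply Rmult_eq_compat_l. apply RInt_ext; intros. apply RInt_ext; intros.
apply RInt_ext; intros. rewrite H; auto using on_SU2_hopf.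
Qed.

Lemma haar_int_R_lin (F G : SU2pt -> R) (x y : R) : bounded_unif F -> bounded_unif G ->
  haar_int_R (fun g => x * F g + y * G g) = x * haar_int_R F + y * haar_int_R G.
Proof.
intros HF HG. rewrite !haar_int_R_int3.
transitivity (/ (2 * PI ^ 2) * int3 (fun p => x * haar_density F p + y * haar_density G p)).
- apply Rmult_eq_compat_l. unfold int3. apply RInt_ext; intros. apply RInt_ext; intros.
  apply RInt_ext; intros. simpl. ring.
- rewrite int3_lin by auto using unif_haar_density. ring.
Qed.

Lemma is_RInt_sin_cos_pow (n : nat) :
  is_RInt (fun eta => sin eta * cos eta * cos eta ^ n) 0 (PI / 2) (/ INR (n + 2)).
Proof.
assert (Hn : INR (n + 2) <> 0) by (apply not_0_INR; lia).
evar_last. apply (is_RInt_derive (V := R_CompleteNormedModule)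
  (fun eta => - / INR (n + 2) * cos eta ^ (n + 2))).
- intros x _. auto_derive; auto. replace (Init.Nat.pred (n + 2)) with (S n) by lia.
  simpl. field. auto.
- intros x _. apply (ex_derive_continuous (fun eta => sin eta * cos eta * cos eta ^ n)).
  auto_derive; auto.
- rewrite cos_PI2, cos_0, pow1, pow_i by lia. unfold minus, plus, opp; simpl. ring.
Qed.

(** The density [sin eta * cos eta] times [cos eta ^ n] has integral [/ INR (n + 2)]. For [n = 0]
    this is the usual bound of the mean by [M]. *)
Lemma haar_int_R_bound (F : SU2pt -> R) (M : R) (n : nat) : bounded_unif F ->
  (forall eta al be, 0 <= eta <= PI / 2 -> Rabs (F (hopf eta al be)) <= M * cos eta ^ n) ->
  Rabs (haar_int_R F) <= 2 * M / INR (n + 2).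
Proof.
intros HF HB. rewrite haar_int_R_int3, Rabs_mult. assert (Hpi := PI_RGT_0).
assert (Hn : INR (n + 2) <> 0) by (apply not_0_INR; lia).
assert (H2 : 0 < 2 * PI ^ 2) by nra.
rewrite (Rabs_right (/ (2 * PI ^ 2))) by (apply Rle_ge; left; apply Rinv_0_lt_compat; auto).
apply Rle_trans with (/ (2 * PI ^ 2) * (4 * PI ^ 2 * (M * / INR (n + 2)))).
- apply Rmult_le_compat_l. left; apply Rinv_0_lt_compat; auto.
  apply int3_bound with (B := fun eta => M * (sin eta * cos eta * cos eta ^ n)).
  + auto using unif_haar_density.
  + intros eta al be He. simpl. rewrite Rabs_mult.
    assert (0 <= sin eta) by (apply sin_ge_0; lra).
    assert (0 <= cos eta) by (apply cos_ge_0; lra).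
    rewrite Rabs_right by (apply Rle_ge, Rmult_le_pos; auto).
    replace (M * (sin eta * cos eta * cos eta ^ n)) with (sin eta * cos eta * (M * cos eta ^ n)) by ring.
    apply Rmult_le_compat_l; auto. apply Rmult_le_pos; auto.
  + apply (is_RInt_scal (V := R_NormedModule) _ _ _ M), is_RInt_sin_cos_pow.
- right. field. split; auto; lra.
Qed.

Lemma hopf_mul_expY0 (eta al be t : R) :
  su2_mul (hopf eta al be) (expY D0 t) = hopf eta (al + t / 2) (be + t / 2).
Proof.
apply SU2pt_ext; simpl; rewrite ?cos_plus, ?sin_plus; ring.
Qed.

(** Right translation along [Y0] shifts both Hopf angles by [t / 2], and the integrand is periodic
    in each. *)
Lemma haar_int_R_translate (F : SU2pt -> R) (t : R) : bounded_unif F ->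
  haar_int_R (fun g => F (su2_mul g (expY D0 t))) = haar_int_R F.
Proof.
intros HF. rewrite !haar_int_R_int3. apply Rmult_eq_compat_l.
rewrite <- (int3_shift (haar_density F) (t / 2)).
- unfold int3. apply RInt_ext; intros. apply RInt_ext; intros.
  apply RInt_ext; intros. unfold haar_density. rewrite hopf_mul_expY0. reflexivity.
- auto using unif_haar_density.
- intros [u eta] al be; unfold haar_density. do 2 f_equal.
  apply SU2pt_ext; simpl; rewrite ?cos_plus, ?sin_plus, ?cos_2PI, ?sin_2PI; ring.
- intros [u eta] al be; unfold haar_density. do 2 f_equal.
  apply SU2pt_ext; simpl; rewrite ?cos_plus, ?sin_plus, ?cos_2PI, ?sin_2PI; ring.
Qed.

Lemma bounded_unif_translate (F : SU2pt -> R) (t : R) : bounded_unif F ->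
  bounded_unif (fun g => F (su2_mul g (expY D0 t))).
Proof.
intros [H1 [M [HM H2]]]. split.
- intros eps He. destruct (H1 eps He) as [d [Hd K]]. exists d; split; auto.
  intros g h Hg Hh A B. destruct (dist_mul_expY0 g h t) as [E1 E2].
  apply K; auto using on_SU2_mul_exp; [rewrite E1|rewrite E2]; auto.
- exists M; split; auto using on_SU2_mul_exp.
Qed.

Lemma bounded_unif_lin (F G : SU2pt -> R) (x y : R) : bounded_unif F -> bounded_unif G ->
  bounded_unif (fun g => x * F g + y * G g).
Proof.
intros [HF [M [HM BM]]] [HG [N [HN BN]]].
assert (Px := Rabs_pos x). assert (Py := Rabs_pos y).
split.
- intros eps He.
  (* [unif] quantifies over a whole type, hence the subtype of group elements. *)
  destruct (unif_lin (X := {g | on_SU2 g})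
     (fun d g h => Cmod (Cminus (fst (proj1_sig h)) (fst (proj1_sig g))) < d /\
       Cmod (Cminus (snd (proj1_sig h)) (snd (proj1_sig g))) < d)
     (fun g => F (proj1_sig g)) (fun g => G (proj1_sig g)) x y) with (4 := He) as [d [Hd K]].
  + intros e He'. destruct (HF e He') as [d [Hd K]]. exists d; split; auto.
    intros [g Hg] [h Hh] [A B]; simpl in *. auto.
  + intros e He'. destruct (HG e He') as [d [Hd K]]. exists d; split; auto.
    intros [g Hg] [h Hh] [A B]; simpl in *. auto.
  + intros d e p q Hde [A B]; split; lra.
  + exists d; split; auto. intros g h Hg Hh A B.
    apply (K (exist _ g Hg) (exist _ h Hh)). simpl; auto.
- exists (Rabs x * M + Rabs y * N + 1). split; [nra|].
  intros g Hg. eapply Rle_trans; [apply Rabs_triang|]. rewrite !Rabs_mult.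
  assert (Rabs x * Rabs (F g) <= Rabs x * M) by (apply Rmult_le_compat_l; auto).
  assert (Rabs y * Rabs (G g) <= Rabs y * N) by (apply Rmult_le_compat_l; auto).
  lra.
Qed.

Lemma dist_orbit (g : SU2pt) (s d : R) : on_SU2 g -> Rabs s < d ->
  Cmod (Cminus (fst (su2_mul g (expY D0 s))) (fst g)) < d /\
  Cmod (Cminus (snd (su2_mul g (expY D0 s))) (snd g)) < d.
Proof.
intros Hg Hs.
set (z := Cminus (fst (expY D0 s)) (RtoC 1)).
assert (Hz : Cmod z < d).
{ replace d with (2 * (d / 2)) by field. apply Cmod_lt_2; simpl.
  - replace (cos (s / 2) + - (1)) with (cos (s / 2) - cos 0) by (rewrite cos_0; ring).
    eapply Rle_lt_trans; [apply cos_lipschitz|].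
    rewrite Rminus_0_r, Rabs_div, (Rabs_right 2); lra.
  - replace (sin (s / 2) + - 0) with (sin (s / 2) - sin 0) by (rewrite sin_0; ring).
    eapply Rle_lt_trans; [apply sin_lipschitz|].
    rewrite Rminus_0_r, Rabs_div, (Rabs_right 2); lra. }
unfold on_SU2 in Hg.
assert (P1 := Cmod_ge_0 (fst g)). assert (P2 := Cmod_ge_0 (snd g)). assert (P3 := Cmod_ge_0 z).
assert (Q1 : Cmod (fst g) <= 1) by nra. assert (Q2 : Cmod (snd g) <= 1) by nra.
split.
- replace (Cminus _ _) with (Cmult (fst g) z).
  rewrite Cmod_mult. nra.
  unfold z, su2_mul, expY; simpl fst; simpl snd. ring.
- replace (Cminus _ _) with (Cmult (snd g) z).
  rewrite Cmod_mult. nra.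
  unfold z, su2_mul, expY; simpl fst; simpl snd. ring.
Qed.

(** By invariance every difference quotient of [F] along [Y0] has integral 0. The mean value theorem
    puts such a quotient uniformly within [eps] of [G] for a small step, so the integral of [G] is
    at most [eps] in modulus. *)
Lemma haar_int_R_deriv (F G : SU2pt -> R) : bounded_unif F -> bounded_unif G ->
  (forall g t, on_SU2 g -> is_derive (fun t => F (su2_mul g (expY D0 t))) t (G (su2_mul g (expY D0 t)))) ->
  haar_int_R G = 0.
Proof.
intros HF HG HD.
assert (K : forall eps, 0 < eps -> Rabs (haar_int_R G) <= eps).
{ intros eps He. destruct HG as [UG BG]. assert (HG : bounded_unif G) by (split; auto).
  destruct (UG eps He) as [d [Hd K]].
  set (t := d / 2). assert (Ht : 0 < t) by (unfold t; lra).
  set (Q := fun g => / t * F (su2_mul g (expY D0 t)) + - / t * F g).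
  assert (GQ : bounded_unif Q) by (apply bounded_unif_lin; auto using bounded_unif_translate).
  assert (HQ : haar_int_R Q = 0).
  { unfold Q. rewrite haar_int_R_lin, haar_int_R_translate by auto using bounded_unif_translate. ring. }
  replace (haar_int_R G) with (haar_int_R (fun g => 1 * G g + -1 * Q g))
    by (rewrite haar_int_R_lin, HQ by auto; ring).
  (* The case [n = 0] of [haar_int_R_bound]. *)
  replace eps with (2 * eps / INR (0 + 2)) by (simpl; field).
  apply haar_int_R_bound. apply bounded_unif_lin; auto.
  intros eta al be _. simpl. set (g := hopf eta al be).
  assert (Hg : on_SU2 g) by apply on_SU2_hopf.
  destruct (MVT_gen (fun t => F (su2_mul g (expY D0 t))) 0 t (fun t => G (su2_mul g (expY D0 t)))) as [c [Hc E]].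
  { intros; apply HD; auto. }
  { intros x _. apply derivable_continuous_pt. eexists. apply is_derive_Reals, HD; auto. }
  rewrite expY_0, su2_mul1 in E.
  replace (1 * G g + -1 * Q g) with (- (G (su2_mul g (expY D0 c)) - G g)).
  2: { unfold Q. replace (F (su2_mul g (expY D0 t))) with
         (F g + G (su2_mul g (expY D0 c)) * (t - 0)) by lra. field. lra. }
  rewrite Rabs_Ropp, Rmult_1_r. left.
  rewrite Rmin_left, Rmax_right in Hc by lra.
  assert (Hcd : Rabs c < d) by (rewrite Rabs_right; unfold t in Hc; lra).
  destruct (dist_orbit g c d Hg Hcd) as [A B].
  apply K; auto using on_SU2_mul_exp. }
destruct (Req_dec (haar_int_R G) 0) as [E|E]; auto.
apply Rabs_pos_lt in E. specialize (K (Rabs (haar_int_R G) / 2)). lra.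
Qed.

Lemma haar_int_ext (F G : SU2pt -> C) : (forall g, on_SU2 g -> F g = G g) ->
  haar_int F = haar_int G.
Proof.
intros H. apply C_ext; apply haar_int_R_ext; intros; rewrite H; auto.
Qed.

Lemma haar_int_plus (F G : SU2pt -> C) : continuous_SU2 F -> continuous_SU2 G ->
  haar_int (fun g => Cplus (F g) (G g)) = Cplus (haar_int F) (haar_int G).
Proof.
intros HF HG. apply C_ext; simpl.
- transitivity (1 * haar_int_R (fun g => Re (F g)) + 1 * haar_int_R (fun g => Re (G g))); [|unfold Re; simpl; ring].
  rewrite <- haar_int_R_lin by auto using bounded_unif_Re. apply haar_int_R_ext; intros; unfold Re; simpl; ring.
- transitivity (1 * haar_int_R (fun g => Im (F g)) + 1 * haar_int_R (fun g => Im (G g))); [|unfold Im; simpl; ring].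
  rewrite <- haar_int_R_lin by auto using bounded_unif_Im. apply haar_int_R_ext; intros; unfold Im; simpl; ring.
Qed.

Lemma haar_int_scal (c : C) (F : SU2pt -> C) : continuous_SU2 F ->
  haar_int (fun g => Cmult c (F g)) = Cmult c (haar_int F).
Proof.
intros HF. apply C_ext; simpl.
- transitivity (Re c * haar_int_R (fun g => Re (F g)) + - Im c * haar_int_R (fun g => Im (F g))); [|unfold Re, Im; simpl; ring].
  rewrite <- haar_int_R_lin by auto using bounded_unif_Re, bounded_unif_Im. apply haar_int_R_ext; intros; unfold Re, Im; simpl; ring.
- transitivity (Im c * haar_int_R (fun g => Re (F g)) + Re c * haar_int_R (fun g => Im (F g))); [|unfold Re, Im; simpl; ring].
  rewrite <- haar_int_R_lin by auto using bounded_unif_Re, bounded_unif_Im. apply haar_int_R_ext; intros; unfold Re, Im; simpl; ring.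
Qed.

Lemma haar_int_conj (F : SU2pt -> C) : continuous_SU2 F ->
  haar_int (fun g => Cconj (F g)) = Cconj (haar_int F).
Proof.
intros HF. apply C_ext; simpl. reflexivity.
transitivity (-1 * haar_int_R (fun g => Im (F g)) + 0 * haar_int_R (fun g => Im (F g))); [|unfold Im; simpl; ring].
rewrite <- haar_int_R_lin by auto using bounded_unif_Im. apply haar_int_R_ext; intros; unfold Im; simpl; ring.
Qed.

Lemma haar_int_by_parts (f phi : SU2pt -> C) : smooth f -> smooth phi ->
  haar_int (fun g => Cmult (Xf D0 f g) (phi g)) = Copp (haar_int (fun g => Cmult (f g) (Xf D0 phi g))).
Proof.
intros Hf Hp.
assert (C1 := smooth_continuous _ Hf). assert (C2 := smooth_continuous _ Hp).
assert (C3 := smooth_continuous _ (smooth_Xf _ D0 Hf)).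
assert (C4 := smooth_continuous _ (smooth_Xf _ D0 Hp)).
set (G := fun g => Cplus (Cmult (Xf D0 f g) (phi g)) (Cmult (f g) (Xf D0 phi g))).
assert (CG : continuous_SU2 G) by (apply continuous_SU2_plus; apply continuous_SU2_mult; auto).
set (F := fun g => Cmult (f g) (phi g)).
assert (CF : continuous_SU2 F) by (apply continuous_SU2_mult; auto).
assert (HD : forall g t, on_SU2 g -> Cderiv (fun t => F (su2_mul g (expY D0 t))) t (G (su2_mul g (expY D0 t)))).
{ intros g t Hg. apply (Cderiv_mult (fun t => f (su2_mul g (expY D0 t))) (fun t => phi (su2_mul g (expY D0 t)))); apply Cderiv_orbit; auto. }
assert (E : haar_int G = RtoC 0).
{ apply C_ext.
  - apply (haar_int_R_deriv (fun g => Re (F g)) (fun g => Re (G g))); auto using bounded_unif_Re.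
    intros; apply HD; auto.
  - apply (haar_int_R_deriv (fun g => Im (F g)) (fun g => Im (G g))); auto using bounded_unif_Im.
    intros; apply HD; auto. }
unfold G in E. rewrite haar_int_plus in E by (apply continuous_SU2_mult; auto).
replace (haar_int (fun g => Cmult (Xf D0 f g) (phi g))) with
  (Cminus (Cplus (haar_int (fun g => Cmult (Xf D0 f g) (phi g))) (haar_int (fun g => Cmult (f g) (Xf D0 phi g))))
     (haar_int (fun g => Cmult (f g) (Xf D0 phi g)))) by ring.
rewrite E. ring.
Qed.

Lemma haar_int_bound (F : SU2pt -> C) (M : R) (n : nat) : continuous_SU2 F ->
  (forall eta al be, 0 <= eta <= PI / 2 -> Cmod (F (hopf eta al be)) <= M * cos eta ^ n) ->
  Cmod (haar_int F) <= 2 * (2 * M / INR (n + 2)).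
Proof.
intros HF HB.
assert (B1 : Rabs (haar_int_R (fun g => Re (F g))) <= 2 * M / INR (n + 2)).
{ apply haar_int_R_bound; auto using bounded_unif_Re. intros; eapply Rle_trans; [apply re_le_Cmod|auto]. }
assert (B2 : Rabs (haar_int_R (fun g => Im (F g))) <= 2 * M / INR (n + 2)).
{ apply haar_int_R_bound; auto using bounded_unif_Im. intros; eapply Rle_trans; [apply Im_le_Cmod|auto]. }
apply Cmod_le_2; [exact B1|exact B2].
Qed.

Lemma Copp_involutive (z : C) : Copp (Copp z) = z.
Proof. ring. Qed.

(** * Inverting [d0 - lam] *)

Definition cexp (lam : C) (t : R) : C :=
  (exp (Re lam * t) * cos (Im lam * t), exp (Re lam * t) * sin (Im lam * t)).

Lemma Cderiv_cexp (lam : C) (t : R) : Cderiv (cexp lam) t (Cmult lam (cexp lam t)).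
Proof.
split; unfold cexp; simpl; auto_derive; auto; unfold Re, Im; ring.
Qed.

Lemma cexp_0 (lam : C) : cexp lam 0 = RtoC 1.
Proof.
unfold cexp, RtoC. rewrite !Rmult_0_r, exp_0, cos_0, sin_0. f_equal; ring.
Qed.

(** With [x = 4 * PI * Im lam], the equation forces [Re lam = 0] and [cos x = 1], so
    [sin (x / 2) = 0] and [x] is a multiple of [2 * PI]; hence the half integers. *)
Lemma cexp_4PI_eq1 (lam : C) : cexp lam (4 * PI) = RtoC 1 ->
  exists n : Z, lam = (0, IZR n / 2).
Proof.
intros H. assert (Hpi := PI_RGT_0).
assert (H1 : exp (Re lam * (4 * PI)) * cos (Im lam * (4 * PI)) = 1) by (apply (f_equal fst) in H; exact H).
assert (H2 : exp (Re lam * (4 * PI)) * sin (Im lam * (4 * PI)) = 0) by (apply (f_equal snd) in H; exact H).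
set (E := exp _) in *. set (x := Im lam * (4 * PI)) in *.
assert (HE : 0 < E) by apply exp_pos.
assert (Hs : sin x = 0) by nra.
assert (Hcc : cos x * cos x = 1) by (generalize (sin2_cos2_mul x); rewrite Hs; lra).
assert (Hc : cos x = 1) by nra.
assert (E1 : E = 1) by (rewrite Hc in H1; lra).
assert (R0 : Re lam = 0).
{ assert (Re lam * (4 * PI) = 0) by (apply exp_inv; rewrite exp_0; exact E1). nra. }
assert (Hx2 : sin (x / 2) = 0).
{ replace x with (2 * (x / 2)) in Hc by field. rewrite cos_2a_sin in Hc. nra. }
destruct (sin_eq_0_0 _ Hx2) as [k Hk]. exists k.
apply C_ext; simpl; auto. unfold x in Hk.
apply Rmult_eq_reg_r with (2 * PI); [|lra]. lra.
Qed.

Definition resolvent (lam : C) (f : SU2pt -> C) : SU2pt -> C :=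
  avg (fun t => Cmult (Cinv (Cminus (cexp (Copp lam) (4 * PI)) (RtoC 1))) (cexp (Copp lam) t)) f.

Lemma Cderiv_scal (c : C) (F : R -> C) (t : R) (l : C) : Cderiv F t l ->
  Cderiv (fun t => Cmult c (F t)) t (Cmult c l).
Proof.
intros H. replace (Cmult c l) with (Cplus (Cmult (RtoC 0) (F t)) (Cmult c l)) by ring.
apply (Cderiv_mult (fun _ => c)); auto. apply Cderiv_const.
Qed.

Lemma Ccont_cexp (lam : C) (t : R) : Ccont (cexp lam) t.
Proof. eapply Cderiv_Ccont, Cderiv_cexp. Qed.

Lemma smooth_resolvent (lam : C) (f : SU2pt -> C) : smooth f -> smooth (resolvent lam f).
Proof.
intros; apply smooth_avg; auto. intros; apply Ccont_mult; [apply Ccont_const|apply Ccont_cexp].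
Qed.

Lemma avg_scal (c : C) (w : R -> C) (f : SU2pt -> C) (g : SU2pt) : (forall t, Ccont w t) ->
  smooth f -> on_SU2 g -> avg (fun t => Cmult c (w t)) f g = Cmult c (avg w f g).
Proof.
intros Hw Hf Hg. unfold avg. rewrite <- CRInt_scal.
- apply CRInt_ext; intros; ring.
- intros; apply Ccont_mult; auto using Ccont_orbit, smooth_continuous.
Qed.

Lemma Xf0_resolvent (lam : C) (f : SU2pt -> C) (g : SU2pt) :
  cexp (Copp lam) (4 * PI) <> RtoC 1 -> smooth f -> on_SU2 g ->
  Xf D0 (resolvent lam f) g = Cplus (f g) (Cmult lam (resolvent lam f g)).
Proof.
intros Hl Hf Hg. unfold resolvent.
set (c := Cinv _). set (w := fun t => Cmult c (cexp (Copp lam) t)).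
assert (Hd : forall t, Cderiv w t (Cmult (Copp lam) (w t))).
{ intros t. unfold w.
  replace (Cmult (Copp lam) (Cmult c (cexp (Copp lam) t))) with
    (Cmult c (Cmult (Copp lam) (cexp (Copp lam) t))) by ring.
  apply Cderiv_scal, Cderiv_cexp. }
assert (Hw : forall t, Ccont w t) by (intros; eapply Cderiv_Ccont, Hd).
rewrite Xf0_avg by auto.
rewrite (avg_Xf0 w (fun t => Cmult (Copp lam) (w t))); auto.
2: { intros; apply Ccont_mult; auto using Ccont_const. }
rewrite avg_scal by auto.
replace (Cminus (w (4 * PI)) (w 0)) with (RtoC 1).
- ring.
- unfold w, c. rewrite cexp_0. field. intros E. apply Hl.
  replace (cexp (Copp lam) (4 * PI)) with
    (Cplus (Cminus (cexp (Copp lam) (4 * PI)) (RtoC 1)) (RtoC 1)) by ring.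
  rewrite E. ring.
Qed.

(** * Distributions *)

(** Test functions are defined on all of [C * C], but the seminorms see only the group: [f1 - f2]
    and all its derivatives vanish there, so the continuity bound holds with [M = 0]. *)
Lemma distribution_ext (u : (SU2pt -> C) -> C) (f1 f2 : SU2pt -> C) : distribution u ->
  smooth f1 -> smooth f2 -> (forall g, on_SU2 g -> f1 g = f2 g) -> u f1 = u f2.
Proof.
intros (Hp & Hs & K & k & HK) H1 H2 E.
set (h := fun g => Cplus (f1 g) (Cmult (RtoC (-1)) (f2 g))).
assert (Hh : smooth h) by (apply smooth_plus; auto using smooth_scal).
assert (Hh0 : forall js g, on_SU2 g -> Xs js h g = RtoC 0).
{ intros js g Hg. rewrite (Xs_ext js h (fun _ => RtoC 0)); auto.
  - clear. revert g. induction js; simpl; intros; auto.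
    apply is_Xf_unique. apply Cderiv_ext with (fun _ => RtoC 0).
    intros; rewrite IHjs; auto. apply Cderiv_const.
  - intros x Hx. unfold h. rewrite E by auto. ring. }
assert (Z : Cmod (u h) <= K * 0).
{ apply HK; auto. intros js _ g Hg. rewrite Hh0, Cmod_0 by auto. lra. }
assert (Z0 : u h = RtoC 0).
{ apply Cmod_eq_0. generalize (Cmod_ge_0 (u h)). lra. }
assert (Q : u h = Cplus (u f1) (Cmult (RtoC (-1)) (u f2))).
{ unfold h. rewrite Hp, Hs; auto using smooth_scal. }
rewrite Z0 in Q.
replace (u f1) with (Cplus (Cplus (u f1) (Cmult (RtoC (-1)) (u f2))) (u f2)).
rewrite <- Q; ring.
apply C_ext; unfold Re, Im; simpl; ring.
Qed.

(** The plus sign makes this the transpose, up to sign, of [d0 - lam]; see [dist_of_d0_shift]. *)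
Definition d0_shift (lam : C) (f : SU2pt -> C) (g : SU2pt) : C :=
  Cplus (Xf D0 f g) (Cmult lam (f g)).

Lemma smooth_d0_shift (lam : C) (f : SU2pt -> C) : smooth f -> smooth (d0_shift lam f).
Proof. intros; apply smooth_plus; auto using smooth_Xf, smooth_scal. Qed.

Lemma d0_shift_resolvent (lam : C) (f : SU2pt -> C) (g : SU2pt) :
  cexp (Copp lam) (4 * PI) <> RtoC 1 -> smooth f -> on_SU2 g ->
  d0_shift (Copp lam) (resolvent lam f) g = f g.
Proof. intros. unfold d0_shift. rewrite Xf0_resolvent by auto. ring. Qed.

Lemma Xf_plus (j : dir) (f1 f2 : SU2pt -> C) (g : SU2pt) : smooth f1 -> smooth f2 -> on_SU2 g ->
  Xf j (fun g => Cplus (f1 g) (f2 g)) g = Cplus (Xf j f1 g) (Xf j f2 g).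
Proof. intros; apply is_Xf_unique, is_Xf_plus; auto using smooth_is_Xf. Qed.

Lemma Xf_scal (j : dir) (c : C) (f : SU2pt -> C) (g : SU2pt) : smooth f -> on_SU2 g ->
  Xf j (fun g => Cmult c (f g)) g = Cmult c (Xf j f g).
Proof. intros; apply is_Xf_unique, is_Xf_scal; auto using smooth_is_Xf. Qed.

Lemma Xf_conj (j : dir) (f : SU2pt -> C) (g : SU2pt) : smooth f -> on_SU2 g ->
  Xf j (fun g => Cconj (f g)) g = Cconj (Xf j f g).
Proof. intros; apply is_Xf_unique, is_Xf_conj; auto using smooth_is_Xf. Qed.

(** Only the sum and the product of the shifts enter, which is what allows passing from [q],
    [Cconj q] to the roots [l1], [l2] later. *)
Lemma d0_shift_comp (a b : C) (f : SU2pt -> C) (g : SU2pt) : smooth f -> on_SU2 g ->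
  d0_shift a (d0_shift b f) g =
  Cplus (Xf D0 (Xf D0 f) g) (Cplus (Cmult (Cplus a b) (Xf D0 f g)) (Cmult (Cmult a b) (f g))).
Proof.
intros Hf Hg. unfold d0_shift at 1. unfold d0_shift at 1.
rewrite Xf_plus, Xf_scal by auto using smooth_Xf, smooth_scal. unfold d0_shift. ring.
Qed.

Lemma dist_of_plus (f1 f2 phi : SU2pt -> C) : smooth f1 -> smooth f2 -> smooth phi ->
  dist_of (fun g => Cplus (f1 g) (f2 g)) phi = Cplus (dist_of f1 phi) (dist_of f2 phi).
Proof.
intros. unfold dist_of. rewrite <- haar_int_plus by auto using continuous_SU2_mult, smooth_continuous.
apply haar_int_ext; intros; ring.
Qed.

Lemma dist_of_scal (c : C) (f phi : SU2pt -> C) : smooth f -> smooth phi ->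
  dist_of (fun g => Cmult c (f g)) phi = Cmult c (dist_of f phi).
Proof.
intros. unfold dist_of. rewrite <- haar_int_scal by auto using continuous_SU2_mult, smooth_continuous.
apply haar_int_ext; intros; ring.
Qed.

Lemma dist_of_ext (f1 f2 phi1 phi2 : SU2pt -> C) : (forall g, on_SU2 g -> f1 g = f2 g) ->
  (forall g, on_SU2 g -> phi1 g = phi2 g) -> dist_of f1 phi1 = dist_of f2 phi2.
Proof. intros H1 H2. unfold dist_of. apply haar_int_ext; intros g Hg. rewrite (H1 g Hg), (H2 g Hg); reflexivity. Qed.

Lemma dist_of_Xf0 (f phi : SU2pt -> C) : smooth f -> smooth phi ->
  dist_of (Xf D0 f) phi = Copp (dist_of f (Xf D0 phi)).
Proof. intros Hf Hp; exact (haar_int_by_parts f phi Hf Hp). Qed.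

Lemma dist_of_d0_shift (lam : C) (f phi : SU2pt -> C) : smooth f -> smooth phi ->
  dist_of (d0_shift (Copp lam) f) phi = Copp (dist_of f (d0_shift lam phi)).
Proof.
intros Hf Hp. unfold d0_shift at 1.
rewrite dist_of_plus, dist_of_scal, dist_of_Xf0 by auto using smooth_Xf, smooth_scal.
replace (dist_of f (d0_shift lam phi)) with (Cplus (dist_of f (Xf D0 phi)) (Cmult lam (dist_of f phi))).
ring.
unfold dist_of. rewrite <- haar_int_scal, <- haar_int_plus by
  auto using continuous_SU2_mult, smooth_continuous, smooth_Xf, continuous_SU2_const.
apply haar_int_ext; intros; unfold d0_shift; ring.
Qed.

Lemma dist_of_conj (f phi : SU2pt -> C) : smooth f -> smooth phi ->
  Cconj (dist_of f (fun g => Cconj (phi g))) = dist_of (fun g => Cconj (f g)) phi.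
Proof.
intros. unfold dist_of. rewrite <- haar_int_conj by
  auto using continuous_SU2_mult, smooth_continuous, smooth_conj.
apply haar_int_ext; intros. rewrite Cmult_conj, Cconj_conj. reflexivity.
Qed.

(* Eliminating the conjugate of [u] from [P u = f] and its conjugate equation
   leaves the constant-coefficient equation below for [u] alone. *)
Lemma Pop_eliminate_conj (p q : C) (u : (SU2pt -> C) -> C) (f : SU2pt -> C) :
  distribution u -> smooth f ->
  (forall phi, smooth phi -> Pop p q u phi = dist_of f phi) ->
  forall phi, smooth phi ->
  Cminus (u (d0_shift q (d0_shift (Cconj q) phi))) (Cmult (RtoC (Cmod p ^ 2)) (u phi)) =
  dist_of (fun g => Cplus (Cmult p (Cconj (f g))) (d0_shift (Copp (Cconj q)) f g)) phi.
Proof.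
intros Hu Hf HP phi Hphi.
assert (HuS : forall c psi, smooth psi -> u (d0_shift c psi) = Cplus (u (Xf D0 psi)) (Cmult c (u psi))).
{ intros c psi Hpsi. destruct Hu as (Ha & Hs & _). unfold d0_shift.
  rewrite Ha, Hs by auto using smooth_Xf, smooth_scal. reflexivity. }
(* [HP1] is the equation tested against [psi]; [HP2] is the conjugate of the equation tested against
   the conjugate of [psi]. *)
assert (HP1 : forall psi, smooth psi -> Cmult p (dconj u psi) =
   Copp (Cplus (u (d0_shift q psi)) (dist_of f psi))).
{ intros psi Hpsi. rewrite HuS by auto. rewrite <- HP by auto.
  unfold Pop, dd0, d0. ring. }
assert (HP2 : forall psi, smooth psi ->
  Cplus (dconj u (d0_shift (Cconj q) psi)) (Cmult (Cconj p) (u psi)) =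
  Copp (dist_of (fun g => Cconj (f g)) psi)).
{ intros psi Hpsi. assert (Hc := smooth_conj _ Hpsi).
  rewrite <- dist_of_conj, <- HP by auto.
  unfold Pop, dd0, d0, dconj.
  assert (E1 : u (fun g => Cconj (d0_shift (Cconj q) psi g)) =
     u (d0_shift q (fun g => Cconj (psi g)))).
  { apply distribution_ext; auto using smooth_conj, smooth_d0_shift.
    intros g Hg. unfold d0_shift. rewrite Xf_conj by auto.
    rewrite Cplus_conj, Cmult_conj, Cconj_conj. reflexivity. }
  assert (E2 : u (fun g => Cconj (Cconj (psi g))) = u psi).
  { apply distribution_ext; auto using smooth_conj. intros; apply Cconj_conj. }
  rewrite E1, E2, HuS by auto.
  rewrite !Cminus_conj, !Cmult_conj, Cplus_conj, Cmult_conj, Copp_conj, Cconj_conj. ring. }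
assert (Hm : RtoC (Cmod p ^ 2) = Cmult p (Cconj p)).
{ apply C_ext; rewrite ?Cmod_sqr; unfold Re, Im; simpl; ring. }
rewrite Hm.
(* Testing [HP1] against [d0_shift (Cconj q) phi] produces the very value of [dconj u] that [HP2]
   expresses through [u phi]. *)
assert (Q1 := HP1 _ (smooth_d0_shift (Cconj q) _ Hphi)).
assert (Q2 := HP2 _ Hphi).
rewrite dist_of_plus, dist_of_scal by auto using smooth_conj, smooth_scal, smooth_d0_shift.
rewrite dist_of_d0_shift by auto.
replace (u (d0_shift q (d0_shift (Cconj q) phi))) with
  (Cminus (Copp (Cmult p (dconj u (d0_shift (Cconj q) phi)))) (dist_of f (d0_shift (Cconj q) phi)))
  by (rewrite Q1; ring).
replace (dist_of (fun g => Cconj (f g)) phi) with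
  (Copp (Cplus (dconj u (d0_shift (Cconj q) phi)) (Cmult (Cconj p) (u phi)))) by (rewrite Q2; ring).
ring.
Qed.

(** In the variable [lam = i m] the symbol is [lam ^ 2 - 2 Re(q) lam + |q|^2 - |p|^2], with roots
    [Re q + mu] and [Re q - mu] where [mu ^ 2 = |p|^2 - (Im q)^2]. This number is real, so [mu] is
    real or purely imaginary according to its sign. *)
Lemma Delta_sym_factor (p q : C) : exists l1 l2 : C,
  Cplus l1 l2 = Cplus q (Cconj q) /\
  Cmult l1 l2 = Cminus (Cmult q (Cconj q)) (RtoC (Cmod p ^ 2)) /\
  forall m, Delta_sym p q m = Cmult (Cminus (0, m) l1) (Cminus (0, m) l2).
Proof.
assert (K : forall l1 l2, Cplus l1 l2 = Cplus q (Cconj q) ->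
  Cmult l1 l2 = Cminus (Cmult q (Cconj q)) (RtoC (Cmod p ^ 2)) ->
  forall m, Delta_sym p q m = Cmult (Cminus (0, m) l1) (Cminus (0, m) l2)).
{ intros l1 l2 H1 H2 m.
  replace (Cmult (Cminus (0, m) l1) (Cminus (0, m) l2)) with
    (Cplus (Cminus (Cmult (0, m) (0, m)) (Cmult (0, m) (Cplus l1 l2))) (Cmult l1 l2)) by ring.
  rewrite H1, H2. unfold Delta_sym. rewrite !Cmod_sqr.
  apply C_ext; unfold Re, Im; simpl; ring. }
set (D := Cmod p ^ 2 - Im q * Im q).
assert (HM : exists mu : C, Cmult mu mu = RtoC D).
{ destruct (Rle_lt_dec 0 D) as [H|H].
  - exists (RtoC (sqrt D)). rewrite <- RtoC_mult, sqrt_sqrt; auto.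
  - exists (0, sqrt (- D)). assert (E := sqrt_sqrt (- D) ltac:(lra)).
    apply C_ext; simpl; lra. }
destruct HM as [mu Hmu].
exists (Cplus (RtoC (Re q)) mu), (Cminus (RtoC (Re q)) mu).
assert (E1 : Cplus (Cplus (RtoC (Re q)) mu) (Cminus (RtoC (Re q)) mu) = Cplus q (Cconj q)).
{ apply C_ext; unfold Re, Im; simpl; ring. }
assert (E2 : Cmult (Cplus (RtoC (Re q)) mu) (Cminus (RtoC (Re q)) mu) =
  Cminus (Cmult q (Cconj q)) (RtoC (Cmod p ^ 2))).
{ replace (Cmult _ _) with (Cminus (Cmult (RtoC (Re q)) (RtoC (Re q))) (Cmult mu mu)) by ring.
  rewrite Hmu. unfold D. apply C_ext; unfold Re, Im; simpl; ring. }
auto.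
Qed.

(** Given [psi], solve [(T + l1) (T + l2) phi = psi] and test the eliminated equation against [phi].
    Its left side becomes [u psi]; writing [F = (T - l2) (T - l1) v] and transposing twice, with two
    cancelling signs, turns its right side into the pairing of [v] with [psi]. *)
Lemma hypoelliptic_of_Delta (p q : C) :
  (forall L k : nat, (k <= L)%nat -> Delta_sym p q (INR L / 2 - INR k) <> RtoC 0) ->
  globally_hypoelliptic (Pop p q).
Proof.
intros HD u Hu [f [Hf Hfu]].
assert (Hel := Pop_eliminate_conj p q u f Hu Hf Hfu).
set (F := fun g => Cplus (Cmult p (Cconj (f g))) (d0_shift (Copp (Cconj q)) f g)) in Hel.
assert (HF : smooth F) by (apply smooth_plus; auto using smooth_scal, smooth_conj, smooth_d0_shift).
destruct (Delta_sym_factor p q) as (l1 & l2 & Hsum & Hprod & Hfac).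
(* Every half integer occurs as an extreme weight: [m = l] for [n >= 0], [m = - l] for [n < 0]. *)
assert (HDZ : forall n : Z, Delta_sym p q (IZR n / 2) <> RtoC 0).
{ intros n. destruct (Z.le_gt_cases 0 n) as [Hn|Hn].
  - specialize (HD (Z.to_nat n) 0%nat ltac:(lia)).
    rewrite INR_IZR_INZ, Z2Nat.id in HD by auto. simpl INR in HD. rewrite Rminus_0_r in HD. exact HD.
  - specialize (HD (Z.to_nat (- n)) (Z.to_nat (- n)) ltac:(lia)).
    rewrite INR_IZR_INZ, Z2Nat.id, opp_IZR in HD by lia.
    replace (- IZR n / 2 - - IZR n) with (IZR n / 2) in HD by field. exact HD. }
(* Both signs are required: inverting [T - l] for [v] uses the exponential of [- l], inverting the
   transpose [T + l] for [phi] that of [l]. *)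
assert (Hn1 : forall l, (forall m, (0, m) = l -> Delta_sym p q m = RtoC 0) ->
  cexp l (4 * PI) <> RtoC 1 /\ cexp (Copp l) (4 * PI) <> RtoC 1).
{ intros l Hl. split; intros E; destruct (cexp_4PI_eq1 _ E) as [n En].
  - apply (HDZ n), Hl. auto.
  - apply (HDZ (- n)%Z), Hl. rewrite opp_IZR. rewrite <- (Copp_involutive l), En.
    apply C_ext; simpl; field. }
assert (P1 : cexp l1 (4 * PI) <> RtoC 1 /\ cexp (Copp l1) (4 * PI) <> RtoC 1).
{ apply Hn1. intros m Em. rewrite Hfac, Em. ring. }
assert (P2 : cexp l2 (4 * PI) <> RtoC 1 /\ cexp (Copp l2) (4 * PI) <> RtoC 1).
{ apply Hn1. intros m Em. rewrite Hfac, Em. ring. }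
destruct P1 as [P1 P1'], P2 as [P2 P2'].
set (v := resolvent l1 (resolvent l2 F)).
assert (Hv : smooth v) by (apply smooth_resolvent, smooth_resolvent, HF).
exists v; split; [exact Hv|]. intros psi Hpsi.
set (phi := resolvent (Copp l2) (resolvent (Copp l1) psi)).
assert (Hphi : smooth phi) by (apply smooth_resolvent, smooth_resolvent, Hpsi).
assert (Ephi : forall g, on_SU2 g -> d0_shift l2 phi g = resolvent (Copp l1) psi g).
{ intros g Hg. rewrite <- (Copp_involutive l2). apply d0_shift_resolvent; auto using smooth_resolvent.
  rewrite Copp_involutive; auto. }
assert (Epsi : forall g, on_SU2 g -> d0_shift l1 (d0_shift l2 phi) g = psi g).
{ intros g Hg. unfold d0_shift at 1. rewrite (Xf_ext D0 _ _ g Hg Ephi), (Ephi g Hg).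
  fold (d0_shift l1 (resolvent (Copp l1) psi) g).
  rewrite <- (Copp_involutive l1) at 1. apply d0_shift_resolvent; auto.
  rewrite Copp_involutive; auto. }
assert (EF : forall g, on_SU2 g -> d0_shift (Copp l2) (d0_shift (Copp l1) v) g = F g).
{ intros g Hg.
  assert (Ev : forall g, on_SU2 g -> d0_shift (Copp l1) v g = resolvent l2 F g).
  { intros; apply d0_shift_resolvent; auto using smooth_resolvent. }
  unfold d0_shift at 1. rewrite (Xf_ext D0 _ _ g Hg Ev), (Ev g Hg).
  apply d0_shift_resolvent; auto. }
transitivity (Cminus (u (d0_shift q (d0_shift (Cconj q) phi))) (Cmult (RtoC (Cmod p ^ 2)) (u phi))).
- assert (Hu' := Hu). destruct Hu' as (Ha & Hs & _).
  transitivity (Cplus (u (d0_shift q (d0_shift (Cconj q) phi))) (Cmult (Copp (RtoC (Cmod p ^ 2))) (u phi))); [|ring].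
  rewrite <- Hs, <- Ha by auto using smooth_scal, smooth_d0_shift.
  apply distribution_ext; auto.
  { apply smooth_plus; auto using smooth_scal, smooth_d0_shift. }
  intros g Hg. rewrite <- Epsi, !d0_shift_comp by auto. rewrite Hsum, Hprod. ring.
- rewrite Hel by auto.
  rewrite (dist_of_ext F (d0_shift (Copp l2) (d0_shift (Copp l1) v)) phi phi);
    [|intros g Hg; symmetry; exact (EF g Hg)|reflexivity].
  rewrite !dist_of_d0_shift by auto using smooth_d0_shift.
  rewrite (dist_of_ext v v _ psi); [ring|reflexivity|exact Epsi].
Qed.

(** * Polynomial test functions *)

(** Conjugation is among the constructors because [Y1] and [Y2] send each coordinate to a multiple
    of the conjugate of the other; the class is thus stable under all three derivatives. *)
Inductive coord_poly : (SU2pt -> C) -> Prop :=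
| poly_const c : coord_poly (fun _ => c)
| poly_fst : coord_poly fst
| poly_snd : coord_poly snd
| poly_conj f : coord_poly f -> coord_poly (fun g => Cconj (f g))
| poly_plus f1 f2 : coord_poly f1 -> coord_poly f2 -> coord_poly (fun g => Cplus (f1 g) (f2 g))
| poly_mult f1 f2 : coord_poly f1 -> coord_poly f2 -> coord_poly (fun g => Cmult (f1 g) (f2 g)).

Lemma continuous_SU2_fst : continuous_SU2 fst.
Proof. intros g Hg eps He; exists eps; auto. Qed.
Lemma continuous_SU2_snd : continuous_SU2 snd.
Proof. intros g Hg eps He; exists eps; auto. Qed.

Lemma is_Xf_fst (j : dir) (g : SU2pt) : is_Xf j fst g
  (match j with D0 => Cmult (0, / 2) (fst g) | D1 => Cmult (RtoC (- / 2)) (Cconj (snd g))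
   | D2 => Cmult (0, - / 2) (Cconj (snd g)) end).
Proof.
destruct g as [[a b] [c d]].
destruct j; split; simpl; auto_derive; auto;
  rewrite ?Rmult_0_l, ?cos_0, ?sin_0; ring.
Qed.

Lemma is_Xf_snd (j : dir) (g : SU2pt) : is_Xf j snd g
  (match j with D0 => Cmult (0, / 2) (snd g) | D1 => Cmult (RtoC (/ 2)) (Cconj (fst g))
   | D2 => Cmult (0, / 2) (Cconj (fst g)) end).
Proof.
destruct g as [[a b] [c d]].
destruct j; split; simpl; auto_derive; auto;
  rewrite ?Rmult_0_l, ?cos_0, ?sin_0; ring.
Qed.

Lemma smooth_coord_poly (f : SU2pt -> C) : coord_poly f -> smooth f.
Proof.
apply smooth_coind. clear f. intros f Hf.
induction Hf as [c| | |f Hf [C1 H1]|f1 f2 P1 [C1 H1] P2 [C2 H2]|f1 f2 P1 [C1 H1] P2 [C2 H2]].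
- split. apply continuous_SU2_const. intros j; exists (fun _ => RtoC 0); split.
  constructor. intros; apply Cderiv_const.
- split. apply continuous_SU2_fst. intros j. eexists; split; [|intros g Hg; apply is_Xf_fst].
  destruct j; repeat constructor.
- split. apply continuous_SU2_snd. intros j. eexists; split; [|intros g Hg; apply is_Xf_snd].
  destruct j; repeat constructor.
- split. apply continuous_SU2_conj; auto. intros j. destruct (H1 j) as [f' [Pf' E]].
  exists (fun g => Cconj (f' g)). split. constructor; auto. intros; apply is_Xf_conj; auto.
- split. apply continuous_SU2_plus; auto. intros j.
  destruct (H1 j) as [f1' [Q1 E1]], (H2 j) as [f2' [Q2 E2]].
  exists (fun g => Cplus (f1' g) (f2' g)). split. constructor; auto. intros; apply is_Xf_plus; auto.
- split. apply continuous_SU2_mult; auto. intros j.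
  destruct (H1 j) as [f1' [Q1 E1]], (H2 j) as [f2' [Q2 E2]].
  exists (fun g => Cplus (Cmult (f1' g) (f2 g)) (Cmult (f1 g) (f2' g))).
  split. apply poly_plus; apply poly_mult; auto. intros; apply is_Xf_mult; auto.
Qed.

Lemma poly_pow (f : SU2pt -> C) (n : nat) : coord_poly f -> coord_poly (fun g => Cpow (f g) n).
Proof.
intros Hf. induction n as [|n IH]; simpl. constructor. apply (poly_mult f); auto.
Qed.

(** On the circle this is a character whose weight depends on [j - i] only, while its modulus at
    [hopf eta al be] is [cos eta ^ (i + j)]: the degree can grow at fixed weight. *)
Definition monomial (i j : nat) (g : SU2pt) : C :=
  Cmult (Cpow (Cconj (fst g)) i) (Cpow (fst g) j).

Lemma smooth_monomial (i j : nat) : smooth (monomial i j).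
Proof.
apply smooth_coord_poly. apply (poly_mult (fun g => Cpow (Cconj (fst g)) i) (fun g => Cpow (fst g) j)).
apply (poly_pow (fun g => Cconj (fst g))), (poly_conj fst), poly_fst.
apply (poly_pow fst), poly_fst.
Qed.

Lemma cis_mult (x y : R) : Cmult (cos x, sin x) (cos y, sin y) = (cos (x + y), sin (x + y)).
Proof. apply C_ext; simpl; rewrite ?cos_plus, ?sin_plus; ring. Qed.

Lemma cis_pow (x : R) (n : nat) : Cpow (cos x, sin x) n = (cos (INR n * x), sin (INR n * x)).
Proof.
induction n as [|n IH].
- simpl. rewrite Rmult_0_l, cos_0, sin_0. reflexivity.
- rewrite Cpow_S, IH, cis_mult, S_INR. f_equal; f_equal; ring.
Qed.

Lemma cis_conj (x : R) : Cconj (cos x, sin x) = (cos (- x), sin (- x)).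
Proof. unfold Cconj; simpl. rewrite cos_neg, sin_neg. reflexivity. Qed.

Lemma monomial_orbit (i j : nat) (t : R) :
  monomial i j (su2_mul su2_one (expY D0 t)) =
  (cos ((INR j - INR i) * (t / 2)), sin ((INR j - INR i) * (t / 2))).
Proof.
unfold monomial. rewrite su2_1mul. simpl fst.
rewrite cis_conj, !cis_pow, cis_mult. f_equal; f_equal; ring.
Qed.

Lemma Cmod_monomial_hopf (i j n : nat) (eta al be : R) : (n <= i + j)%nat -> 0 <= eta <= PI / 2 ->
  Cmod (monomial i j (hopf eta al be)) <= cos eta ^ n.
Proof.
intros Hn He. assert (Hpi := PI_RGT_0).
assert (Hc : 0 <= cos eta) by (apply cos_ge_0; lra).
assert (Hc1 : cos eta <= 1) by apply COS_bound.
assert (Hm : Cmod (fst (hopf eta al be)) = cos eta).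
{ apply Rsqr_inj; auto using Cmod_ge_0.
  unfold Rsqr. replace (Cmod _ * Cmod _) with (Cmod (fst (hopf eta al be)) ^ 2) by ring.
  rewrite Cmod_sqr; simpl.
  transitivity (cos eta * cos eta * (sin al * sin al + cos al * cos al)). ring.
  rewrite sin2_cos2_mul; ring. }
unfold monomial. rewrite Cmod_mult, !Cmod_pow, Cmod_conj, Hm, <- pow_add.
replace (i + j)%nat with (n + (i + j - n))%nat by lia. rewrite pow_add.
rewrite <- (Rmult_1_r (cos eta ^ n)) at 2.
apply Rmult_le_compat_l. apply pow_le; auto.
rewrite <- (pow1 (i + j - n)). apply pow_incr; auto.
Qed.

(** * Distributions carried by a circle *)

Definition circle_dist (e : R -> C) (phi : SU2pt -> C) : C := avg e phi su2_one.

Lemma distribution_circle (e : R -> C) : (forall t, Ccont e t) -> distribution (circle_dist e).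
Proof.
intros He. assert (Hon := on_SU2_one).
assert (Hc : forall f, smooth f -> forall t, Ccont (fun t => Cmult (e t) (f (su2_mul su2_one (expY D0 t)))) t).
{ intros; apply Ccont_mult; auto using Ccont_orbit, smooth_continuous. }
split; [|split].
- intros f1 f2 H1 H2. unfold circle_dist, avg. rewrite <- CRInt_plus by auto.
  apply CRInt_ext; intros; ring.
- intros c f Hf. unfold circle_dist, avg. rewrite <- CRInt_scal by auto.
  apply CRInt_ext; intros; ring.
- destruct (Ccont_bounded e 0 (4 * PI) He) as [W [HW KW]].
  exists (2 * (4 * PI * W)), 0%nat. intros f M Hf HM.
  replace (2 * (4 * PI * W) * M) with (2 * ((4 * PI - 0) * (W * M))) by ring.
  apply CRInt_bound; auto. generalize PI_RGT_0; lra.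
  intros t Ht. rewrite Cmod_mult. apply Rmult_le_compat; auto using Cmod_ge_0.
  apply (HM nil); auto using on_SU2_mul_exp.
Qed.

Lemma circle_dist_plus (e1 e2 : R -> C) (phi : SU2pt -> C) : (forall t, Ccont e1 t) ->
  (forall t, Ccont e2 t) -> smooth phi ->
  circle_dist (fun t => Cplus (e1 t) (e2 t)) phi = Cplus (circle_dist e1 phi) (circle_dist e2 phi).
Proof.
intros H1 H2 Hp. unfold circle_dist, avg. rewrite <- CRInt_plus.
- apply CRInt_ext; intros; ring.
- intros; apply Ccont_mult; auto using Ccont_orbit, smooth_continuous, on_SU2_one.
- intros; apply Ccont_mult; auto using Ccont_orbit, smooth_continuous, on_SU2_one.
Qed.

Lemma circle_dist_scal (c : C) (e : R -> C) (phi : SU2pt -> C) : (forall t, Ccont e t) ->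
  smooth phi -> circle_dist (fun t => Cmult c (e t)) phi = Cmult c (circle_dist e phi).
Proof. intros He Hp; exact (avg_scal c e phi su2_one He Hp on_SU2_one). Qed.

Lemma circle_dist_ext (e1 e2 : R -> C) (phi : SU2pt -> C) : (forall t, e1 t = e2 t) ->
  circle_dist e1 phi = circle_dist e2 phi.
Proof. intros H. apply CRInt_ext; intros; rewrite H; auto. Qed.

(** On the circle, [dd0] turns the density [e] into its derivative, periodicity cancelling the
    boundary term, and [dconj] turns it into its conjugate. So [P u = 0] becomes the stated
    differential equation. *)
Lemma Pop_circle_dist (p q : C) (e : R -> C) (phi : SU2pt -> C) :
  (forall t, Cderiv e t (Cplus (Cmult q (e t)) (Cmult p (Cconj (e t))))) ->
  e (4 * PI) = e 0 -> smooth phi -> Pop p q (circle_dist e) phi = RtoC 0.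
Proof.
intros He Hper Hp.
assert (Hc : forall t, Ccont e t) by (intros; eapply Cderiv_Ccont, He).
assert (Hcc : forall t, Ccont (fun t => Cconj (e t)) t) by auto using @Ccont_conj.
assert (Hs : forall c (f : R -> C), (forall t, Ccont f t) -> forall t, Ccont (fun t => Cmult c (f t)) t).
{ intros; apply Ccont_mult; auto using Ccont_const. }
assert (E1 : dd0 (circle_dist e) phi =
  Cplus (Cmult q (circle_dist e phi)) (Cmult p (circle_dist (fun t => Cconj (e t)) phi))).
{ unfold dd0, d0, circle_dist.
  rewrite (avg_Xf0 e _ phi su2_one He); auto using on_SU2_one.
  - rewrite Hper. fold (circle_dist (fun t => Cplus (Cmult q (e t)) (Cmult p (Cconj (e t)))) phi).
    rewrite circle_dist_plus, (circle_dist_scal q), (circle_dist_scal p) by auto.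
    unfold circle_dist. ring.
  - intros; apply Ccont_plus; auto. }
assert (E2 : dconj (circle_dist e) phi = circle_dist (fun t => Cconj (e t)) phi).
{ unfold dconj, circle_dist, avg. rewrite <- CRInt_conj.
  - apply CRInt_ext; intros. rewrite Cmult_conj, Cconj_conj. reflexivity.
  - intros; apply Ccont_mult; auto. apply Ccont_conj.
    auto using Ccont_orbit, smooth_continuous, on_SU2_one. }
unfold Pop. rewrite E1, E2. ring.
Qed.

Lemma smooth_dist_zero (u : (SU2pt -> C) -> C) : (forall phi, smooth phi -> u phi = RtoC 0) ->
  smooth_dist u.
Proof.
intros H. exists (fun _ => RtoC 0). split. apply smooth_const.
intros phi Hp. rewrite H by auto. symmetry.
transitivity (haar_int (fun g => Cmult (RtoC 0) (phi g))). reflexivity.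
rewrite haar_int_scal by auto using smooth_continuous. ring.
Qed.

Lemma cexp_half_integer (L k : nat) : cexp (0, INR L / 2 - INR k) (4 * PI) = RtoC 1.
Proof.
unfold cexp; simpl. set (x := (INR L / 2 - INR k) * (4 * PI)).
(* [x = 2 PI L - 4 PI k] may be negative, and [cos_period] adds a natural number of periods: adding
   [2 * k] of them to [x] gives [L] periods from 0. *)
assert (E : x + 2 * INR (2 * k) * PI = 0 + 2 * INR L * PI).
{ unfold x. rewrite mult_INR; simpl. field. }
rewrite <- (cos_period x (2 * k)), <- (sin_period x (2 * k)), E, cos_period, sin_period.
rewrite Rmult_0_l, exp_0, cos_0, sin_0. unfold RtoC. f_equal; ring.
Qed.

Lemma cexp_imag (m t : R) : cexp (0, m) t = (cos (m * t), sin (m * t)).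
Proof. unfold cexp; simpl. rewrite Rmult_0_l, exp_0. f_equal; ring. Qed.

(** The exponents differ by [2 k - L], which is [-2 m] for [m = L / 2 - k]; at half angle the
    monomial is [e^(-i m t)] and cancels the density, for every [n]. *)
Lemma circle_dist_monomial (L k n : nat) :
  circle_dist (cexp (0, INR L / 2 - INR k)) (monomial (L + n) (2 * k + n)) = RtoC (4 * PI).
Proof.
unfold circle_dist, avg.
rewrite (CRInt_ext _ (fun _ => RtoC 1)).
- apply C_ext; simpl; rewrite RInt_const; unfold scal; simpl; unfold mult; simpl; ring.
- intros t. rewrite cexp_imag, monomial_orbit, cis_mult.
  replace (_ + _) with 0.
  rewrite cos_0, sin_0; reflexivity.
  rewrite !plus_INR, mult_INR; simpl. field.
Qed.

Lemma dist_of_monomial_small (f : SU2pt -> C) : smooth f -> exists M, 0 < M /\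
  forall i j n, (n <= i + j)%nat -> Cmod (dist_of f (monomial i j)) <= M / INR (n + 2).
Proof.
intros Hf. destruct (continuous_SU2_bounded f (smooth_continuous _ Hf)) as [M [HM B]].
exists (4 * M). split; [lra|]. intros i j n Hn.
replace (4 * M / INR (n + 2)) with (2 * (2 * M / INR (n + 2))) by (field; apply not_0_INR; lia).
unfold dist_of. apply haar_int_bound.
- auto using continuous_SU2_mult, smooth_continuous, smooth_monomial.
- intros. rewrite Cmod_mult. apply Rmult_le_compat; auto using Cmod_ge_0, on_SU2_hopf, Cmod_monomial_hopf.
Qed.

Lemma Delta_of_hypoelliptic (p q : C) (L k : nat) : p <> RtoC 0 ->
  globally_hypoelliptic (Pop p q) -> Delta_sym p q (INR L / 2 - INR k) <> RtoC 0.
Proof.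
intros hp HG HD.
set (m := INR L / 2 - INR k) in *.
set (E := cexp (0, m)).
assert (hp' : Cconj p <> RtoC 0).
{ intros H. apply hp. rewrite <- (Cconj_conj p), H. apply C_ext; simpl; ring. }
(* Comparing the coefficients of [al E] and of [Cconj al * Cconj E] in [e' = q e + p conj e] gives
   [i m = q + p conj c] and [- i m c = q c + p]. The first determines [c], since [p] is nonzero
   ([Hc1]); the second then amounts to the vanishing of the conjugate of [Delta_sym p q m]
   ([Hc2]). *)
set (c := Cdiv (Copp (Cplus (0, m) (Cconj q))) (Cconj p)).
set (e := fun al t => Cplus (Cmult al (E t)) (Cmult (Cmult (Cconj al) c) (Cconj (E t)))).
assert (Hc1 : Cmult p (Cconj c) = Cminus (0, m) q).
{ assert (H : Cmult (Cconj p) c = Copp (Cplus (0, m) (Cconj q))) by (unfold c; field; auto).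
  apply (f_equal Cconj) in H. rewrite Cmult_conj, Cconj_conj in H. rewrite H.
  apply C_ext; unfold Re, Im; simpl; ring. }
assert (Hc2 : Cplus (Cmult q c) p = Cmult (Copp (0, m)) c).
{ assert (H : Cplus (Cmult (Cplus (0, m) q) (Cplus (0, m) (Cconj q))) (Copp (Cmult p (Cconj p))) = RtoC 0).
  { apply (f_equal Cconj) in HD. transitivity (Cconj (Delta_sym p q m)).
    - unfold Delta_sym. rewrite !Cmod_sqr. apply C_ext; unfold Re, Im; simpl; ring.
    - rewrite HD. apply C_ext; simpl; ring. }
  assert (H' : Cmult p (Cconj p) = Cmult (Cplus (0, m) q) (Cplus (0, m) (Cconj q))).
  { replace (Cmult p (Cconj p)) with (Cminus (Cmult (Cplus (0, m) q) (Cplus (0, m) (Cconj q))) (Cplus (Cmult (Cplus (0, m) q) (Cplus (0, m) (Cconj q))) (Copp (Cmult p (Cconj p))))) by ring.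
    rewrite H. ring. }
  replace p with (Cdiv (Cmult p (Cconj p)) (Cconj p)) at 1 by (field; auto).
  rewrite H'. unfold c. field. auto. }
assert (HE : forall t, Cderiv E t (Cmult (0, m) (E t))) by (intros; apply Cderiv_cexp).
assert (HEc : forall t, Cderiv (fun t => Cconj (E t)) t (Cmult (Copp (0, m)) (Cconj (E t)))).
{ intros t. replace (Cmult (Copp (0, m)) (Cconj (E t))) with (Cconj (Cmult (0, m) (E t))).
  apply Cderiv_conj, HE. rewrite Cmult_conj. f_equal. apply C_ext; simpl; ring. }
assert (He : forall al t, Cderiv (e al) t (Cplus (Cmult q (e al t)) (Cmult p (Cconj (e al t))))).
{ intros al t. unfold e.
  replace (Cplus (Cmult q _) _) with (Cplus (Cmult al (Cmult (0, m) (E t)))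
     (Cmult (Cmult (Cconj al) c) (Cmult (Copp (0, m)) (Cconj (E t))))).
  - apply Cderiv_plus; apply Cderiv_scal; auto.
  - rewrite Cplus_conj, !Cmult_conj, !Cconj_conj.
    transitivity (Cplus (Cmult (Cmult al (E t)) (Cplus q (Cmult p (Cconj c))))
       (Cmult (Cmult (Cconj al) (Cconj (E t))) (Cplus (Cmult q c) p))); [|ring].
    rewrite Hc1, Hc2. ring. }
assert (Hec : forall al t, Ccont (e al) t) by (intros; eapply Cderiv_Ccont, He).
assert (Hper : forall al, e al (4 * PI) = e al 0).
{ intros al. unfold e, E. rewrite cexp_0. unfold m. rewrite cexp_half_integer. reflexivity. }
assert (Hsm : forall al, smooth_dist (circle_dist (e al))).
{ intros al. apply HG. apply distribution_circle; auto.
  apply smooth_dist_zero. intros; apply Pop_circle_dist; auto. }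
destruct (Hsm (RtoC 1)) as [f1 [S1 K1]]. destruct (Hsm Ci) as [f2 [S2 K2]].
destruct (dist_of_monomial_small f1 S1) as [M1 [HM1 B1]].
destruct (dist_of_monomial_small f2 S2) as [M2 [HM2 B2]].
(* This [n] makes the two pairings with the monomial add up to less than 1 in modulus, against
   [8 * PI] on the circle. *)
destruct (nfloor_ex (M1 + M2)) as [n [_ Hn]]; [lra|].
set (phi := monomial (L + n) (2 * k + n)).
assert (Hphi : smooth phi) by apply smooth_monomial.
(* Pointwise [e_1 - i e_i = 2 E]: the conjugate-linear terms cancel. *)
assert (Eq : Cmult (RtoC 2) (RtoC (4 * PI)) =
  Cplus (dist_of f1 phi) (Cmult (Copp Ci) (dist_of f2 phi))).
{ rewrite <- K1, <- K2 by auto.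
  rewrite <- (circle_dist_monomial L k n). fold m phi. fold E.
  assert (HEC : forall t, Ccont E t) by (intros; eapply Cderiv_Ccont, HE).
  rewrite <- (circle_dist_scal (RtoC 2) E phi HEC Hphi).
  rewrite <- (circle_dist_scal (Copp Ci) (e Ci) phi (Hec Ci) Hphi).
  rewrite <- circle_dist_plus;
    [|exact (Hec _)|intros t; apply Ccont_mult; [apply Ccont_const|apply Hec]|exact Hphi].
  apply circle_dist_ext. intros t. unfold e.
  apply C_ext; unfold Re, Im; simpl; ring. }
assert (Q1 := B1 (L + n)%nat (2 * k + n)%nat n ltac:(lia)).
assert (Q2 := B2 (L + n)%nat (2 * k + n)%nat n ltac:(lia)).
fold phi in Q1, Q2.
assert (Hn2 : M1 + M2 < INR (n + 2)) by (rewrite plus_INR; simpl; lra).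
assert (Q3 : M1 / INR (n + 2) + M2 / INR (n + 2) < 1).
{ replace (M1 / INR (n + 2) + M2 / INR (n + 2)) with ((M1 + M2) / INR (n + 2)) by (field; lra).
  apply Rmult_lt_reg_r with (INR (n + 2)); [lra|]. unfold Rdiv.
  rewrite Rmult_assoc, Rinv_l; lra. }
apply (f_equal Cmod) in Eq.
rewrite <- RtoC_mult, Cmod_R, Rabs_right in Eq by (generalize PI_RGT_0; lra).
assert (T := Cmod_triangle (dist_of f1 phi) (Cmult (Copp Ci) (dist_of f2 phi))).
rewrite Cmod_mult, Cmod_opp, Cmod_Ci, <- Eq in T.
generalize PI2_3_2; intros. unfold PI2 in *. lra.
Qed.

(* ell = L/2, m = ell - k with 0 <= k <= L, i.e. -ell <= m <= ell, ell - m in N_0 *)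
Theorem theorem5p3 (p q : C) (hp : p <> RtoC 0) :
  globally_hypoelliptic (Pop p q) <->
  (forall (L k : nat), (k <= L)%nat ->
     Delta_sym p q (INR L / 2 - INR k) <> RtoC 0).
Proof.
split.
- intros H L k _. apply Delta_of_hypoelliptic; assumption.
- apply hypoelliptic_of_Delta.
Qed.
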